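(* Let $n\ge1$ be an integer, $k\ge\frac{n-1}{2n}$, $p\in[1,+\infty]$, $a>0$, and let $f$ be a measurable function on $\mathbb{R}$ such that $x\mapsto e^{na|x|^{2/n}}f(x)$ belongs to $L^p_{k,n}$. Then $\mathcal{T}_1f(z)$ is well defined for every $z\in\mathbb{C}$, $\mathcal{T}_1 f$ is an entire function, and there is a constant $C>0$ (independent of $z$) such that $$|\mathcal{T}_1f(z)|\le C\,e^{\frac{n}{4a}(\operatorname{Im} z)^2}\qquad\text{for all }z\in\mathbb{C}.$$
   Context: Notation: $\alpha=kn-\frac n2$; $j_\beta(z)=\Gamma(\beta+1)\sum_{m\ge0}\frac{(-1)^m}{m!\,\Gamma(\beta+m+1)}(z/2)^{2m}$ is the normalized Bessel function; $d\mu_{k,n}(x)=\frac{1}{2\Gamma(kn-\frac n2+1)}(\frac n2)^{kn-\frac n2}|x|^{2k+\frac2n-2}dx$ and $L^p_{k,n}=L^p(\mathbb{R},d\mu_{k,n})$. For a function $f$, $f_e(x)=\frac{f(x)+f(-x)}2$ and $f_o(x)=\frac{f(x)-f(-x)}2$. Define for $z\in\mathbb{C}$ $$\mathcal{T}_1f(z)=\int_{\mathbb{R}} f_e(u)\,j_{kn-\frac n2}\big(nz|u|^{1/n}\big)\,d\mu_{k,n}(u).$$ *)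

(* Defs.v *)
From HB Require Import structures.
From mathcomp Require Import all_boot all_order all_algebra.
From mathcomp Require Import all_classical all_reals all_analysis.
From mathcomp Require Import measurable_realfun hoelder.
From mathcomp Require Import complex.

Set Implicit Arguments.
Unset Strict Implicit.
Unset Printing Implicit Defensive.

Import Order.TTheory GRing.Theory Num.Theory.
Import numFieldNormedType.Exports.

Local Open Scope classical_set_scope.
Local Open Scope ring_scope.

(* (only used for s > 0, where the integral converges).               *)
Definition Gamma (R : realType) (s : R) : R :=
  Rintegral (@lebesgue_measure R) `]0%R, +oo[
    (fun t => t `^ (s - 1) * expR (- t)).

Definition density_measure (R : realType) (g : R -> R)
  (mg : measurable_fun [set: R] g) (g0 : forall x, 0 <= g x)
  (A : set R) : \bar R :=
  (\int[@lebesgue_measure R]_(x in A) (g x)%:E)%E.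

Section density_measure.
Context (R : realType) (g : R -> R).
Hypotheses (mg : measurable_fun [set: R] g) (g0 : forall x, 0 <= g x).
Local Notation density_measure := (density_measure mg g0).

Let dm0 : density_measure set0 = 0%E.
Proof. by rewrite /density_measure integral_set0. Qed.

Let dm_ge0 A : (0 <= density_measure A)%E.
Proof. by apply: integral_ge0 => x _; rewrite lee_fin. Qed.

Let dm_sigma : semi_sigma_additive density_measure.
Proof.
apply: (@semi_sigma_additive_nng_induced _ _ R (@lebesgue_measure R) (EFin \o g)).
- exact/measurable_EFinP.
- by move=> x; rewrite lee_fin.
Qed.

HB.instance Definition _ := isMeasure.Build _ _ _ density_measure
  dm0 dm_ge0 dm_sigma.

End density_measure.

Definition alpha (R : realType) (k : R) (n : nat) : R := k * n%:R - n%:R / 2.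

Definition mukn_density (R : realType) (k : R) (n : nat) (x : R) : R :=
  `| (2 * Gamma (alpha k n + 1))^-1 * (n%:R / 2) `^ (alpha k n) |
  * `|x| `^ (2 * k + 2 / n%:R - 2).

Lemma mukn_density_measurable (R : realType) (k : R) (n : nat) :
  measurable_fun [set: R] (mukn_density k n).
Proof.
apply: measurable_funM; first exact: measurable_cst.
apply: (measurableT_comp (measurable_powR _)).
exact: normr_measurable.
Qed.

Lemma mukn_density_ge0 (R : realType) (k : R) (n : nat) (x : R) :
  0 <= mukn_density k n x.
Proof. by rewrite /mukn_density mulr_ge0 ?powR_ge0. Qed.

Definition mukn (R : realType) (k : R) (n : nat) :=
  @density_measure R (mukn_density k n) (@mukn_density_measurable R k n) (@mukn_density_ge0 R k n).

Definition jbessel (R : realType) (beta : R) (w : R[i]) : R[i] :=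
  limn (series (fun m : nat =>
    ((Gamma (beta + 1) * (-1) ^+ m / (m`!%:R * Gamma (beta + m%:R + 1)))%:C%C
     * (w / 2) ^+ (2 * m) : R[i]^o))).

Definition even_part (R : realType) (f : R -> R[i]) (x : R) : R[i] :=
  (f x + f (- x)) / 2.

Definition T1_integrand (R : realType) (k : R) (n : nat) (f : R -> R[i])
  (z : R[i]) (u : R) : R[i] :=
  even_part f u * jbessel (alpha k n) ((n%:R * `|u| `^ (n%:R)^-1)%:C%C * z).

Definition cre (R : realType) (z : R[i]) : R := complex.Re z.
Definition cim (R : realType) (z : R[i]) : R := complex.Im z.

Definition T1_defined (R : realType) (k : R) (n : nat) (f : R -> R[i])
  (z : R[i]) : Prop :=
  (mukn k n).-integrable [set: R] (fun u => (cre (T1_integrand k n f z u))%:E)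
  /\ (mukn k n).-integrable [set: R] (fun u => (cim (T1_integrand k n f z u))%:E).

Definition T1 (R : realType) (k : R) (n : nat) (f : R -> R[i]) (z : R[i])
  : R[i] :=
  Complex (Rintegral (mukn k n) [set: R] (fun u => cre (T1_integrand k n f z u)))
          (Rintegral (mukn k n) [set: R] (fun u => cim (T1_integrand k n f z u))).

Definition cmod (R : realType) (z : R[i]) : R := ComplexField.Normc.normc z.

(* Main.v *)
Require Import Defs.
From HB Require Import structures.
From mathcomp Require Import all_boot all_order all_algebra.
From mathcomp Require Import all_classical all_reals all_analysis.
From mathcomp Require Import measurable_realfun hoelder.
From mathcomp Require Import complex.
From mathcomp Require Import ess_sup_inf ring lra zify.
Import Order.TTheory GRing.Theory Num.Theory.
Import numFieldNormedType.Exports.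
Local Open Scope classical_set_scope.
Local Open Scope ring_scope.

Set Implicit Arguments.
Unset Strict Implicit.
Unset Printing Implicit Defensive.

(** On the positive half-line the density of the measure is a constant times
    [r^(2 g) dr] in the variable [r = |u|^(1/n)], with [g = alpha + 1/2 >= 0].
    The weight [exp(n a r^2)] turns the integrand into a function [F] of [L^p]
    times [exp(-n a r^2) j(n z r)], and [|j(w)| <= exp |Im w|] alone would give
    the claim only up to a power of [|Im z|]. The missing power comes from the
    decay [|j(w)| <= K exp |Im w| / (1 + |Im w|^g)]: completing the square with
    [b = |Im z| / (2 a)] leaves
    [exp(-n a (r - b)^2) / (1 + (2 n a b r)^g) r^(2 g) <= C / (1 + (r - b)^2)],
    whose integral is bounded uniformly in [b].

    The decay is read off the Poisson integral of [j] against the positive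
    density [(1 - t^2)^(g - 1)] on [[0, 1]], which is obtained by comparing
    moments. Complex differentiability follows from a second-order Taylor
    estimate of the power series of [j], integrated against [f]. *)

(** * Integrals on the half-line and the Gamma function *)

(** The exponent n/(4a) comes from -n a r^2 + n r |Im z| = -n a (r - b)^2 + n (Im z)^2 / (4 a), and
    it leaves no room for a polynomial loss. Near r = b the weight r^(2 g) has size b^(2 g), while
    |Im w| = n r |Im z| = 2 n a b r is of order b^2 there, so a decay of order |Im w|^(-g)
    compensates it exactly. The moments to be compared are the coefficients of j relative to the
    cosine series and the even moments of the Poisson density. Both satisfy M(m+1) (2 alpha + 2 m +
    2) = M(m) (2 m + 1): the first by Gamma(s+1) = s Gamma(s), the second by integration by parts.
    This is why the Gamma function is studied at the start. At the endpoint k = (n-1)/(2n), where g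
    = 0, the Poisson density degenerates to a point mass at t = 1: j is the cosine, 1 + |Im w|^0 is
    the constant 2, and this case is treated apart. Complex quantities are reduced throughout to
    finite sums, real sequences and real integrals of projections. *)

Section real_integrable.
Context d (T : measurableType d) (R : realType).
Variables (mu : {measure set T -> \bar R}) (D : set T).
Hypothesis mD : measurable D.
Implicit Types f g : T -> R.

Lemma integrableZl_EFin (r : R) f : mu.-integrable D (EFin \o f) ->
  mu.-integrable D (EFin \o (fun x => r * f x)).
Proof. by move=> fi; exact: (integrableZl mD r fi). Qed.

Lemma integrableD_EFin f g : mu.-integrable D (EFin \o f) ->
  mu.-integrable D (EFin \o g) -> mu.-integrable D (EFin \o (fun x => f x + g x)).
Proof. by move=> fi gi; exact: (integrableD mD fi gi). Qed.

Lemma integrableB_EFin f g : mu.-integrable D (EFin \o f) ->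
  mu.-integrable D (EFin \o g) -> mu.-integrable D (EFin \o (fun x => f x - g x)).
Proof. by move=> fi gi; exact: (integrableB mD fi gi). Qed.

Lemma integrable_le_ge0 f g : measurable_fun D f ->
  mu.-integrable D (EFin \o g) -> (forall x, D x -> `|f x| <= g x) ->
  mu.-integrable D (EFin \o f).
Proof.
move=> mf gi fg; apply: le_integrable gi => //; first exact/measurable_EFinP.
by move=> x Dx /=; rewrite lee_fin (le_trans (fg x Dx))// ler_norm.
Qed.

End real_integrable.

Section integrals_on_half_line.
Context {R : realType}.
Local Notation mu := (@lebesgue_measure R).
Implicit Types (f F g : R -> R) (a b s c x : R).

Lemma integral_is_derive f F a b : a < b ->
  {in `[a, b], forall x, {for x, continuous f}} ->
  {in `[a, b], forall x, is_derive x 1 F (f x)} ->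
  (\int[mu]_(x in `[a, b]) (f x)%:E = (F b - F a)%:E)%E.
Proof.
move=> ab cf dF.
have cF x : x \in `[a, b] -> {for x, continuous F}.
  by move=> /dF[dx _]; apply/differentiable_continuous/derivable1_diffP.
rewrite (@continuous_FTC2 _ f F)//.
- apply: continuous_in_subspaceT => x; rewrite inE; exact: cf.
- split.
  + by move=> x /subset_itv_oo_cc /dF[].
  + by apply: cvg_at_right_filter; apply: cF; rewrite in_itv/= lexx ltW.
  + by apply: cvg_at_left_filter; apply: cF; rewrite in_itv/= lexx ltW.
- by move=> x /subset_itv_oo_cc /dF[_ <-]; rewrite derive1E.
Qed.

(** Compact intervals inside the open half-line, where real powers are differentiable whatever the
    exponent. The offset 2 gives 1/N < 1 < N, so the endpoints are strictly ordered already at index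
    0. *)
Definition exhaust0y (n : nat) : set R := [set` `[n.+2%:R^-1, n.+2%:R]].

Lemma exhaust0y_pos n x : exhaust0y n x -> 0 < x.
Proof. by rewrite /exhaust0y/= in_itv/= => /andP[+ _]; apply: lt_le_trans. Qed.

Lemma exhaust0y_lt n : (n.+2%:R^-1 : R) < n.+2%:R.
Proof.
apply: (@lt_trans _ _ 1); last by rewrite ltr1n.
by rewrite invf_lt1 ?ltr1n.
Qed.

Lemma bigcup_exhaust0y : \bigcup_n exhaust0y n = `]0, +oo[%classic.
Proof.
apply/seteqP; split => [x [n _ /exhaust0y_pos x0]|x/=].
  by rewrite /= in_itv/= x0.
rewrite in_itv/= andbT => x0.
exists (Num.bound (x + x^-1)) => //=.
have xx0 : 0 <= x + x^-1 by rewrite addr_ge0// ?invr_ge0 ltW.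
have := archi_boundP xx0; set N := Num.bound _ => Nx.
have N2 : (N%:R : R) <= N.+2%:R by rewrite ler_nat -addn2 leq_addr.
rewrite /exhaust0y/= in_itv/=; apply/andP; split.
  rewrite -(invrK x) lef_pV2 ?posrE ?invr_gt0//.
  by rewrite (le_trans _ N2)// (le_trans _ (ltW Nx))// lerDr ltW.
by rewrite (le_trans _ N2)// (le_trans _ (ltW Nx))// lerDl invr_ge0 ltW.
Qed.

Lemma exhaust0y_nondecreasing : nondecreasing_seq exhaust0y.
Proof.
apply/nondecreasing_seqP => n; rewrite subsetEset /exhaust0y => x/=.
rewrite !in_itv/= => /andP[h1 h2].
have h : (n.+2%:R : R) <= n.+3%:R by rewrite ler_nat.
rewrite (le_trans h2 h) andbT (le_trans _ h1)//.
by rewrite lef_pV2 ?posrE.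
Qed.

Lemma cvg_integral_exhaust0y f : measurable_fun (`]0%R, +oo[ : set R) f ->
  (forall x, 0 < x -> 0 <= f x) ->
  (\int[mu]_(x in exhaust0y n) (f x)%:E @[n --> \oo] -->
  \int[mu]_(x in `]0%R, +oo[) (f x)%:E)%E.
Proof.
move=> mf f0; rewrite -bigcup_exhaust0y.
apply: ge0_nondecreasing_set_cvg_integral.
- exact: exhaust0y_nondecreasing.
- by move=> i; exact: measurable_itv.
- move=> i; apply/measurable_EFinP; apply: measurable_funS mf => //.
  by move=> x /exhaust0y_pos; rewrite /= in_itv/= andbT.
- by move=> i x /exhaust0y_pos x0; rewrite lee_fin f0.
Qed.

Lemma continuous_pos_measurable f :
  (forall x, 0 < x -> {for x, continuous f}) ->
  measurable_fun (`]0%R, +oo[ : set R) f.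
Proof.
move=> cf; apply: open_continuous_measurable_fun => //.
by move=> x; rewrite inE/= in_itv/= andbT => /cf.
Qed.

(** By monotone convergence along the compact exhaustion, a bound on the increments of a primitive
    bounds the improper integral; the behaviour at 0 and at infinity enters only through that
    bound. *)
Lemma le_integral0y_is_derive f F (M : R) :
  (forall x, 0 < x -> 0 <= f x) ->
  (forall x, 0 < x -> {for x, continuous f}) ->
  (forall x, 0 < x -> is_derive x 1 F (f x)) ->
  (forall a b, 0 < a -> a < b -> F b - F a <= M) ->
  (\int[mu]_(x in `]0%R, +oo[) (f x)%:E <= M%:E)%E.
Proof.
move=> f0 cf dF FM.
have cvg := cvg_integral_exhaust0y (continuous_pos_measurable cf) f0.
rewrite -(cvg_lim _ cvg)//.
apply: lime_le; first by apply/cvg_ex; eexists; exact: cvg.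
apply: nearW => n; rewrite (@integral_is_derive f F).
- by rewrite lee_fin FM ?exhaust0y_lt.
- exact: exhaust0y_lt.
- by move=> x /exhaust0y_pos/cf.
- by move=> x /exhaust0y_pos/dF.
Qed.

End integrals_on_half_line.

Section exponential_growth.
Context {R : realType}.
Implicit Types s c x : R.

Lemma powR_le1DX s x (N : nat) : 0 <= s -> s <= N%:R -> 0 <= x ->
  x `^ s <= 1 + x ^+ N.
Proof.
move=> s0 sN x0; have [x1|x1] := leP x 1.
  rewrite (@le_trans _ _ 1)// ?lerDl ?exprn_ge0//.
  have <- : 1 `^ s = 1 :> R by rewrite powR1.
  by apply: ge0_ler_powR; rewrite ?nnegrE.
apply: (@le_trans _ _ (x `^ N%:R)); first by apply: ler_powR => //; exact: ltW.
by rewrite powR_mulrn// lerDr.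
Qed.

(** One Taylor term is enough: with N.+1 >= s, (c x)^s <= 1 + (c x)^(N+1) <= (N+1)! exp(c x). *)
Lemma powR_le_expR s c : 0 <= s -> 0 < c ->
  exists2 C, 0 < C & forall x, 0 <= x -> x `^ s <= C * expR (c * x).
Proof.
move=> s0 c0; pose N := Num.bound s.
have sN : s <= N.+1%:R.
  by rewrite (le_trans (ltW (archi_boundP s0)))// ler_nat.
have cs0 : 0 < c `^ s by exact: powR_gt0.
have fact0 : 0 < N.+1`!%:R :> R by rewrite ltr0n fact_gt0.
exists ((c `^ s)^-1 * N.+1`!%:R) => [|x x0]; first by rewrite mulr_gt0 ?invr_gt0.
rewrite -mulrA ler_pdivlMl// -powRM// ?(ltW c0)//.
have cx0 : 0 <= c * x by rewrite mulr_ge0// ltW.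
rewrite (le_trans (powR_le1DX s0 sN cx0))//.
apply: le_trans (ler_wpM2l (ltW fact0) (expR_ge1Dxn N cx0)).
rewrite mulrDr mulr1 mulrCA divff ?gt_eqF// mulr1 lerD2r.
by rewrite ler1n fact_gt0.
Qed.

(** The square (1 + x^s)^2 is chosen because its reciprocal leads to explicit primitives: of t^(s-1)
    / (1 + t^s)^2 for the Gamma integral, and of 1 / (1 + Y v)^2 for the decay of j. *)
Lemma sqr1DpowR_le_expR s : 0 <= s ->
  exists2 C, 0 < C & forall x, 0 <= x -> (1 + x `^ s) ^+ 2 <= C * expR x.
Proof.
move=> s0; have [C C0 hC] := powR_le_expR (mulr_ge0 s0 (ler0n R 2)) ltr01.
exists (2 * (1 + C)) => [|x x0]; first by rewrite mulr_gt0// addr_gt0.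
have := hC x x0; rewrite mul1r powRrM powR_mulrn ?powR_ge0// => h.
have e1 : 1 <= expR x by rewrite -expR0 ler_expR.
have := sqr_ge0 (1 - x `^ s); nra.
Qed.

End exponential_growth.

Section gamma_function.
Context {R : realType}.
Local Notation mu := (@lebesgue_measure R).
Implicit Types s t x : R.

Lemma is_derive_continuous (F : R -> R) x d :
  is_derive x 1 F d -> {for x, continuous F}.
Proof. by case=> dF _; exact/differentiable_continuous/derivable1_diffP. Qed.

Lemma continuous_powR_pos s t : 0 < t -> {for t, continuous (fun x : R => x `^ s)}.
Proof. by move=> t0; apply: is_derive_continuous (is_derive1_powR s t0). Qed.

Lemma powR_posB1 s t : 0 < t -> t * t `^ (s - 1) = t `^ s.
Proof.
move=> t0; rewrite -{1}(powRr1 (ltW t0)) -powRD; last by rewrite (gt_eqF t0) implybT.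
by rewrite addrC subrK.
Qed.

Definition gamma_integrand s t := t `^ (s - 1) * expR (- t).

Lemma gamma_integrand_ge0 s t : 0 <= gamma_integrand s t.
Proof. by rewrite mulr_ge0 ?powR_ge0 ?expR_ge0. Qed.

Lemma continuous_gamma_integrand s t : 0 < t ->
  {for t, continuous (gamma_integrand s)}.
Proof.
move=> t0; apply: cvgM; first exact: continuous_powR_pos.
by apply: continuous_comp; [exact: opp_continuous|exact: continuous_expR].
Qed.

Lemma measurable_gamma_integrand s :
  measurable_fun (`]0%R, +oo[ : set R) (gamma_integrand s).
Proof.
apply: continuous_pos_measurable => t; exact: continuous_gamma_integrand.
Qed.

Lemma is_derive_neg_inv1DpowR s t : 0 < s -> 0 < t ->
  is_derive t 1 (fun t => - s^-1 * (1 + t `^ s)^-1)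
    (t `^ (s - 1) * (1 + t `^ s) ^- 2).
Proof.
move=> s0 t0.
have d1 : is_derive t 1 (fun t => 1 + t `^ s) (s * t `^ (s - 1)).
  rewrite -[X in is_derive _ _ _ X]add0r.
  exact: is_deriveD (is_derive_cst _ _ _) (is_derive1_powR s t0).
have n0 : 1 + t `^ s != 0 by rewrite gt_eqF// ltr_pwDl// powR_ge0.
have d2 := @is_deriveV _ (fun t => 1 + t `^ s) _ _ _ n0 d1.
have d3 := is_deriveZ (- s^-1) d2.
apply: (is_derive_eq d3).
rewrite /GRing.scale/=; field.
by rewrite n0 gt_eqF.
Qed.

(** One majorant controls both ends of the half-line: exp(-t) <= C / (1 + t^s)^2, and t^(s-1) / (1 +
    t^s)^2 has the primitive -(1/s) / (1 + t^s), whose increments are at most 1/s. *)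
Lemma integrable_gamma_integrand s : 0 < s ->
  mu.-integrable `]0%R, +oo[ (EFin \o gamma_integrand s).
Proof.
move=> s0; have mg := measurable_gamma_integrand s.
have [C C0 hC] := sqr1DpowR_le_expR (ltW s0).
pose g t := t `^ (s - 1) * (1 + t `^ s) ^- 2.
have cg t : 0 < t -> {for t, continuous g}.
  move=> t0; apply: cvgM; first exact: continuous_powR_pos.
  apply: cvgV; first by rewrite sqrf_eq0 gt_eqF// ltr_pwDl// powR_ge0.
  apply: (@continuous_comp _ _ _ (fun t : R => 1 + t `^ s) (fun y : R => y ^+ 2)).
    by apply: cvgD; [exact: cvg_cst|exact: continuous_powR_pos].
  exact: exprn_continuous.
have g0 t : 0 < t -> 0 <= g t.
  by move=> t0; rewrite mulr_ge0 ?powR_ge0// invr_ge0 sqr_ge0.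
have Ig : (\int[mu]_(x in `]0%R, +oo[) (g x)%:E <= (s^-1)%:E)%E.
  apply: le_integral0y_is_derive => //.
    by move=> t t0; exact: is_derive_neg_inv1DpowR.
  move=> a b a0 ab /=; rewrite !mulNr opprK addrC -mulrBr.
  rewrite -[leRHS]mulr1 ler_wpM2l ?invr_ge0 ?(ltW s0)//.
  rewrite lerBlDr (@le_trans _ _ 1)//.
    by rewrite invf_le1 ?lerDl ?powR_ge0// ltr_pwDl// powR_ge0.
  by rewrite lerDl invr_ge0 addr_ge0// powR_ge0.
have ig : mu.-integrable `]0%R, +oo[ (fun t => C%:E * (g t)%:E)%E.
  apply: integrableZl => //; apply/integrableP; split.
    by apply/measurable_EFinP; exact: continuous_pos_measurable.
  under eq_integral => t.
    rewrite inE/= in_itv/= andbT => /g0 gt0; rewrite ger0_norm//; over.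
  by rewrite (le_lt_trans Ig) ?ltry.
apply: le_integrable ig => //; first exact/measurable_EFinP.
move=> t /=; rewrite in_itv/= andbT => t0.
rewrite lee_fin ger0_norm ?gamma_integrand_ge0//.
rewrite ger0_norm; last by rewrite mulr_ge0 ?g0// ltW.
rewrite /g mulrCA ler_wpM2l ?powR_ge0// expRN ler_pdivlMr; last first.
  by rewrite exprn_gt0// ltr_pwDl// powR_ge0.
by rewrite mulrC ler_pdivrMr ?expR_gt0// hC// ltW.
Qed.

(** On [1, 2] one has 0 <= ln t <= 1, hence t^(s-1) exp(-t) >= exp(-|s-1| - 2); the integral over
    this interval is already positive. *)
Lemma Gamma_gt0 s : 0 < s -> 0 < Gamma s.
Proof.
move=> s0; have ig := integrable_gamma_integrand s0.
have fin : (\int[mu]_(x in `]0%R, +oo[) (gamma_integrand s x)%:E)%E \is a fin_num.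
  exact: integrable_fin_num ig.
suff : (0 < \int[mu]_(x in `]0%R, +oo[) (gamma_integrand s x)%:E)%E.
  by move=> h; apply: fine_gt0; rewrite h ltey_eq fin.
have sub : (`[1%R, 2%R] : set R) `<=` `]0%R, +oo[.
  move=> x/=; rewrite !in_itv/= andbT => /andP[h _].
  exact: lt_le_trans h.
apply: (@lt_le_trans _ _ (\int[mu]_(x in `[1%R, 2%R]) (gamma_integrand s x)%:E)%E);
  last first.
  apply: ge0_subset_integral => //=.
    by apply/measurable_EFinP; exact: measurable_gamma_integrand.
  by move=> x _; rewrite lee_fin gamma_integrand_ge0.
apply: (@lt_le_trans _ _ (\int[mu]_(x in `[1%R, 2%R])
    (expR (- `|s - 1| - 2))%:E)%E).
  rewrite integral_cst//= lebesgue_measure_itv/= lte_fin ltr1n/=.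
  by rewrite -EFinD -EFinM lte_fin mulr_gt0 ?expR_gt0// subr_gt0 ltr1n.
apply: ge0_le_integral => //=.
- apply/measurable_EFinP.
  exact: measurable_funS (measurable_gamma_integrand s).
move=> x; rewrite in_itv/= => /andP[x1 x2].
have x0 : 0 < x by exact: lt_le_trans x1.
rewrite lee_fin /gamma_integrand /powR gt_eqF// -expRD ler_expR lerB//.
have l0 := ln_ge0 x1.
have l1 : ln x <= 1.
  by rewrite -[x](addrNK 1) addrC (le_trans (le_ln1Dx _))// ?lerBlDr// ltrBrDl subrr.
have n0 := normr_ge0 (s - 1).
have := ler_norm (- (s - 1)); rewrite normrN => n1.
have : 0 <= (`|s - 1| + (s - 1)) * ln x by apply: mulr_ge0 => //; lra.
have : 0 <= `|s - 1| * (1 - ln x) by apply: mulr_ge0 => //; lra.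
lra.
Qed.

(** Integration by parts: the derivative of t^s exp(-t) is integrated over the exhausting intervals.
    The limit is 0 by the boundary values and s Gamma(s) - Gamma(s+1) by linearity. *)
Lemma GammaS s : 0 < s -> Gamma (s + 1) = s * Gamma s.
Proof.
move=> s0; have s10 : 0 < s + 1 by rewrite addr_gt0.
have cvgG r : 0 < r ->
    Rintegral mu (exhaust0y n) (gamma_integrand r) @[n --> \oo] --> Gamma r.
  move=> r0; apply: fine_cvg; rewrite fineK.
    apply: cvg_integral_exhaust0y; first exact: measurable_gamma_integrand.
    by move=> x _; exact: gamma_integrand_ge0.
  by apply: integrable_fin_num (integrable_gamma_integrand r0).
have ig n r : 0 < r ->
    mu.-integrable (exhaust0y n) (EFin \o gamma_integrand r).
  move=> r0; apply: integrableS (integrable_gamma_integrand r0) => //.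
    exact: measurable_itv.
  by move=> x /exhaust0y_pos; rewrite /= in_itv/= andbT.
pose F t := t `^ s * expR (- t).
pose f t := s * gamma_integrand s t - gamma_integrand (s + 1) t.
have fE n : Rintegral mu (exhaust0y n) f = F n.+2%:R - F n.+2%:R^-1.
  rewrite /Rintegral (@integral_is_derive _ f F)//; first exact: exhaust0y_lt.
    move=> t /exhaust0y_pos t0; apply: cvgB; last exact: continuous_gamma_integrand.
    by apply: cvgM; [exact: cvg_cst|exact: continuous_gamma_integrand].
  move=> t /exhaust0y_pos t0.
  have dp := is_derive1_powR s t0.
  have de : is_derive t 1 (fun t : R => expR (- t)) (- expR (- t)).
    apply: (is_derive_eq (is_derive1_comp (is_derive_expR _) (is_deriveNid _ _))).
    by rewrite mulrN1.
  rewrite /F; apply: is_derive_eq.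
  rewrite /f /gamma_integrand addrK /GRing.scale/=; ring.
have c0 : F n.+2%:R - F n.+2%:R^-1 @[n --> \oo] --> 0.
  rewrite -[X in _ --> X](subr0 0); apply: cvgB.
    (* The exponent is one more than the power in [F]; the surplus factor bounds the upper boundary
       term by C / N. *)
    have [C C0 hC] := @powR_le_expR R (s + 1) 1 (ltW s10) ltr01.
    apply: (@squeeze_cvgr _ _ _ _ (cst 0) (fun n => C * n.+2%:R^-1)).
    - apply: nearW => n; rewrite /F mulr_ge0 ?powR_ge0 ?expR_ge0//=.
      rewrite expRN ler_pdivrMr ?expR_gt0// mulrAC ler_pdivlMr//.
      have := hC n.+2%:R (ler0n _ _); rewrite mul1r; apply: le_trans.
      by rewrite -(powR_posB1 (s + 1))// addrK mulrC.
    - exact: cvg_cst.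
    - rewrite -(mulr0 C); apply: cvgM; first exact: cvg_cst.
      by have := @cvg_harmonic R; rewrite -cvg_shiftS.
  have F0 : F x @[x --> 0^'+] --> 0 * expR (- 0).
    apply: cvgM; first exact: powR_cvg0.
    apply: cvg_at_right_filter; apply: continuous_comp; first exact: opp_continuous.
    exact: continuous_expR.
  rewrite mul0r in F0.
  move/cvg_at_rightP : F0; apply; split.
    by move=> n; rewrite invr_gt0.
  by have := @cvg_harmonic R; rewrite -cvg_shiftS.
have c1 : F n.+2%:R - F n.+2%:R^-1 @[n --> \oo] --> s * Gamma s - Gamma (s + 1).
  under eq_fun => n.
    rewrite -fE /f RintegralB//=; last 3 first.
    - exact: measurable_itv.
    - by apply: integrableZl_EFin; [exact: measurable_itv|exact: ig].
    - exact: ig.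
    rewrite RintegralZl//=; last 2 first.
    - exact: measurable_itv.
    - exact: ig.
    over.
  by apply: cvgB; [apply: cvgM; [exact: cvg_cst|exact: cvgG]|exact: cvgG].
have /cvg_lim e1 := c1; have /cvg_lim e0 := c0.
by apply/esym/eqP; rewrite -subr_eq0 -e1// e0.
Qed.

End gamma_function.

(** * Complex modulus and series *)

Section complex_modulus.
Context {R : realType}.
Implicit Types (z w : R[i]) (r : R).

Lemma real_complexB (x y : R) : (x - y)%:C%C = x%:C%C - y%:C%C.
Proof. exact: rmorphB. Qed.

Lemma real_complexM (x y : R) : (x * y)%:C%C = x%:C%C * y%:C%C.
Proof. exact: rmorphM. Qed.

Lemma real_complexX (x : R) n : (x ^+ n)%:C%C = x%:C%C ^+ n.
Proof. exact: rmorphXn. Qed.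

Lemma real_complexV (x : R) : (x^-1)%:C%C = x%:C%C^-1.
Proof. exact: fmorphV. Qed.

Lemma real_complex_nat n : (n%:R : R)%:C%C = n%:R.
Proof. exact: rmorph_nat. Qed.

Lemma real_complexN1 : (-1 : R)%:C%C = -1.
Proof. exact: rmorphN1. Qed.

Lemma cmodE z : cmod z = Num.sqrt (cre z ^+ 2 + cim z ^+ 2).
Proof. by case: z. Qed.

Lemma cmod_ge0 z : 0 <= cmod z.
Proof. by rewrite cmodE sqrtr_ge0. Qed.

Lemma normE_cmod z : `|z| = (cmod z)%:C%C.
Proof. by rewrite cmodE normc_def. Qed.

Lemma cmodM z w : cmod (z * w) = cmod z * cmod w.
Proof. exact: ComplexField.Normc.normcM. Qed.

Lemma cmodD z w : cmod (z + w) <= cmod z + cmod w.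
Proof. by rewrite -lecR -normE_cmod rmorphD/= -!normE_cmod ler_normD. Qed.

Lemma cmodN z : cmod (- z) = cmod z.
Proof. by rewrite !cmodE; case: z => a b /=; rewrite !sqrrN. Qed.

Lemma cmodB z w : cmod (z - w) <= cmod z + cmod w.
Proof. by rewrite -(cmodN w) cmodD. Qed.

Lemma cmod_distC z w : cmod (z - w) = cmod (w - z).
Proof. by rewrite -cmodN opprB. Qed.

Lemma cmod_real r : cmod r%:C%C = `|r|.
Proof. by rewrite cmodE/= expr0n/= addr0 sqrtr_sqr. Qed.

Lemma cmod0 : cmod (0 : R[i]) = 0.
Proof. by rewrite (cmod_real 0) normr0. Qed.

Lemma cmod1 : cmod (1 : R[i]) = 1.
Proof. by rewrite (cmod_real 1) normr1. Qed.

Lemma cmodX z n : cmod (z ^+ n) = cmod z ^+ n.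
Proof. by elim: n => [|n ih]; rewrite ?expr0 ?cmod1// !exprS cmodM ih. Qed.

Lemma cmod_eq0 z : cmod z = 0 -> z = 0.
Proof. exact: ComplexField.Normc.eq0_normc. Qed.

Lemma cmodV z : cmod z^-1 = (cmod z)^-1.
Proof. exact: ComplexField.Normc.normcV. Qed.

Lemma cmod_sum n (F : 'I_n -> R[i]) :
  cmod (\sum_(i < n) F i) <= \sum_(i < n) cmod (F i).
Proof.
apply: (big_ind2 (fun x y => cmod x <= y)) => //; first by rewrite cmod0.
by move=> x1 x2 y1 y2 h1 h2; rewrite (le_trans (cmodD _ _))// lerD.
Qed.

Lemma creD z w : cre (z + w) = cre z + cre w. Proof. by case: z w => ? ? []. Qed.
Lemma cimD z w : cim (z + w) = cim z + cim w. Proof. by case: z w => ? ? []. Qed.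
Lemma creN z : cre (- z) = - cre z. Proof. by case: z. Qed.
Lemma cimN z : cim (- z) = - cim z. Proof. by case: z. Qed.
Lemma creM z w : cre (z * w) = cre z * cre w - cim z * cim w.
Proof. by case: z w => ? ? []. Qed.
Lemma cimM z w : cim (z * w) = cre z * cim w + cim z * cre w.
Proof. by case: z w => ? ? [] ? ?. Qed.
Lemma creZ r z : cre (r%:C%C * z) = r * cre z.
Proof. by rewrite creM/= mul0r subr0. Qed.
Lemma cimZ r z : cim (r%:C%C * z) = r * cim z.
Proof. by rewrite cimM/= mul0r addr0. Qed.

Lemma cre_sum n (F : 'I_n -> R[i]) : cre (\sum_(i < n) F i) = \sum_(i < n) cre (F i).
Proof. exact: (big_morph (@cre R) creD). Qed.

Lemma cim_sum n (F : 'I_n -> R[i]) : cim (\sum_(i < n) F i) = \sum_(i < n) cim (F i).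
Proof. exact: (big_morph (@cim R) cimD). Qed.

Lemma complex_ext z w : cre z = cre w -> cim z = cim w -> z = w.
Proof. by case: z w => ? ? [] ? ? /= -> ->. Qed.

Lemma norm_cre z : `|cre z| <= cmod z.
Proof. by rewrite cmodE -sqrtr_sqr ler_wsqrtr// lerDl sqr_ge0. Qed.

Lemma norm_cim z : `|cim z| <= cmod z.
Proof. by rewrite cmodE -sqrtr_sqr ler_wsqrtr// lerDr sqr_ge0. Qed.

Lemma sqr_cmod z : cmod z ^+ 2 = cre z ^+ 2 + cim z ^+ 2.
Proof. by rewrite cmodE sqr_sqrtr// addr_ge0// sqr_ge0. Qed.

Lemma cmod_le_norm z : cmod z <= `|cre z| + `|cim z|.
Proof.
rewrite -(@ler_pXn2r _ 2)// ?nnegrE ?cmod_ge0 ?addr_ge0//.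
rewrite sqr_cmod sqrrD !real_normK ?num_real// lerD2r lerDl.
by rewrite mulrn_wge0// mulr_ge0.
Qed.

Lemma dual_le_cmod z (c s : R) : c ^+ 2 + s ^+ 2 = 1 ->
  c * cre z + s * cim z <= cmod z.
Proof.
move=> cs; have [h|h] := leP (c * cre z + s * cim z) 0.
  exact: le_trans h (cmod_ge0 z).
rewrite -(@ler_pXn2r _ 2)// ?nnegrE ?cmod_ge0 ?(ltW h)// sqr_cmod.
(* Lagrange's identity: this square is the defect in the Cauchy-Schwarz inequality. *)
have := sqr_ge0 (c * cim z - s * cre z).
rewrite -[X in _ -> _ <= X]mul1r -cs => h'; rewrite -subr_ge0.
by move: h'; congr (_ <= _); ring.
Qed.

(* The modulus is the largest of the projections on unit directions; this
   turns bounds on complex integrals into bounds on real ones. *)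
Lemma cmod_le_dual z (B : R) :
  (forall c s, c ^+ 2 + s ^+ 2 = 1 -> c * cre z + s * cim z <= B) ->
  cmod z <= B.
Proof.
move=> h; have [z0|z0] := eqVneq (cmod z) 0.
  rewrite z0; have := h 1 0; rewrite expr1n expr0n addr0 => /(_ erefl).
  by rewrite (cmod_eq0 z0)/= mulr0 mul0r addr0.
have := h (cre z / cmod z) (cim z / cmod z).
rewrite !expr_div_n -mulrDl -sqr_cmod divff ?sqrf_eq0// => /(_ erefl).
apply: le_trans; rewrite mulrAC [X in _ + X]mulrAC -mulrDl -!expr2 -sqr_cmod.
by rewrite expr2 mulfK.
Qed.

(** The remainders satisfy E(n+1) = (z + w) E(n) + (n+2) w^2 z^(n+1), which gives an induction. The
    factor (n+2)(n+1) is what turns 1/(n+2)! into 1/n! when the bound is summed over a power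
    series. *)
Lemma pow_taylor2 z w n :
  cmod ((z + w) ^+ n.+2 - z ^+ n.+2 - n.+2%:R * w * z ^+ n.+1) <=
  cmod w ^+ 2 * (n.+2 * n.+1)%:R * (cmod z + cmod w) ^+ n.
Proof.
set r := cmod z + cmod w.
have r0 : 0 <= r by rewrite addr_ge0 ?cmod_ge0.
have zr : cmod z <= r by rewrite lerDl cmod_ge0.
have nat_cmod m : cmod (m%:R : R[i]) = m%:R.
  by rewrite -[m%:R in LHS](rmorph_nat (real_complex R)) cmod_real normr_nat.
elim: n => [|n ih].
  rewrite expr0 mulr1 expr1 (_ : _ - _ - _ = w ^+ 2); last by ring.
  by rewrite cmodX ler_peMr ?sqr_ge0// ler1n.
rewrite (_ : _ - _ - _ = (z + w) * ((z + w) ^+ n.+2 - z ^+ n.+2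
    - n.+2%:R * w * z ^+ n.+1) + n.+2%:R * (w ^+ 2 * z ^+ n.+1)); last first.
  rewrite !exprS -[n.+3%:R]natr1; ring.
rewrite (le_trans (cmodD _ _))// !cmodM nat_cmod !cmodX.
have h1 : cmod (z + w) * cmod ((z + w) ^+ n.+2 - z ^+ n.+2
    - n.+2%:R * w * z ^+ n.+1) <= r * (cmod w ^+ 2 * (n.+2 * n.+1)%:R * r ^+ n).
  by apply: ler_pM => //; rewrite ?cmod_ge0// cmodD.
have h2 : n.+2%:R * (cmod w ^+ 2 * cmod z ^+ n.+1) <=
    n.+2%:R * (cmod w ^+ 2 * r ^+ n.+1).
  rewrite ler_wpM2l// ler_wpM2l ?sqr_ge0//.
  by apply: lerXn2r => //; rewrite nnegrE cmod_ge0.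
rewrite (le_trans (lerD h1 h2))// -subr_ge0.
rewrite (_ : _ - _ = cmod w ^+ 2 * r ^+ n.+1 *
   ((n.+3 * n.+2)%:R - (n.+2 * n.+1)%:R - n.+2%:R)); last by rewrite [r ^+ n.+1]exprS; ring.
rewrite !mulr_ge0 ?cmod_ge0 ?exprn_ge0//.
rewrite -addrA -opprD -natrD subr_ge0 ler_nat; lia.
Qed.

End complex_modulus.

Section complex_series.
Context {R : realType}.
Implicit Types (u t : nat -> R[i]) (l z : R[i]) (e v : nat -> R).

(** Convergence in [R[i]] through the real sequence of distances, so that real limit theorems apply;
    [ccvg_cvg] returns to the topology in which [jbessel] takes its limit. *)
Definition ccvg u l := cmod (u n - l) @[n --> \oo] --> (0 : R).

Lemma ccvg_le u l e : (forall n, cmod (u n - l) <= e n) ->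
  e n @[n --> \oo] --> 0 -> ccvg u l.
Proof.
move=> ue e0; apply: (@squeeze_cvgr _ _ _ _ (cst 0) e) => //; last exact: cvg_cst.
by apply: nearW => n; rewrite cmod_ge0 ue.
Qed.

Lemma ccvgB u1 u2 l1 l2 : ccvg u1 l1 -> ccvg u2 l2 ->
  ccvg (fun n => u1 n - u2 n) (l1 - l2).
Proof.
move=> h1 h2; apply: (@ccvg_le _ _ (fun n => cmod (u1 n - l1) + cmod (u2 n - l2))).
  move=> n; rewrite (_ : _ - _ - _ = (u1 n - l1) - (u2 n - l2)); last by ring.
  exact: cmodB.
by rewrite -[X in _ --> X]addr0; exact: cvgD.
Qed.

Lemma ccvgZ z u l : ccvg u l -> ccvg (fun n => z * u n) (z * l).
Proof.
move=> h; apply: (@ccvg_le _ _ (fun n => cmod z * cmod (u n - l))).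
  by move=> n; rewrite -mulrBr cmodM.
by rewrite -[X in _ --> X](mulr0 (cmod z)); apply: cvgM => //; exact: cvg_cst.
Qed.

Lemma ccvg_cre u l : ccvg u l -> cre (u n) @[n --> \oo] --> cre l.
Proof.
move=> h; apply/cvgrPdist_lt => e e0; move/cvgr_dist_lt : h => /(_ e e0).
apply: filterS => n; rewrite sub0r normrN ger0_norm ?cmod_ge0//.
apply: le_lt_trans; rewrite -creN -creD.
by rewrite -(opprB l) cmodN; exact: norm_cre.
Qed.

Lemma ccvg_cim u l : ccvg u l -> cim (u n) @[n --> \oo] --> cim l.
Proof.
move=> h; apply/cvgrPdist_lt => e e0; move/cvgr_dist_lt : h => /(_ e e0).
apply: filterS => n; rewrite sub0r normrN ger0_norm ?cmod_ge0//.
apply: le_lt_trans; rewrite -cimN -cimD.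
by rewrite -(opprB l) cmodN; exact: norm_cim.
Qed.

Lemma ccvg_cmod_le u l e (B : R) : ccvg u l ->
  (forall n, cmod (u n) <= e n) -> e n @[n --> \oo] --> B -> cmod l <= B.
Proof.
move=> ul ue eB.
have h : e n + cmod (u n - l) @[n --> \oo] --> B + 0 by exact: cvgD.
rewrite addr0 in h; rewrite -(cvg_lim _ h)//.
apply: limr_ge; first by apply/cvg_ex; eexists; exact: h.
apply: nearW => n; rewrite -[l in cmod l](subKr (u n)) (le_trans (cmodB _ _))//.
by rewrite lerD.
Qed.

Lemma ccvg_cvg u l : ccvg u l -> (u : nat -> R[i]^o) @ \oo --> (l : R[i]^o).
Proof.
move=> ul; apply/cvgrPdist_lt => e e0.
have ee : e = (complex.Re e)%:C%C by rewrite RRe_real// gtr0_real.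
have e0' : 0 < complex.Re e by rewrite -ltcR -ee.
move/cvgr_dist_lt : ul => /(_ _ e0'); apply: filterS => n.
rewrite sub0r normrN ger0_norm ?cmod_ge0// => h.
by rewrite normE_cmod ee ltcR cmod_distC.
Qed.

Lemma ccvg_limn u l : ccvg u l -> limn (u : nat -> R[i]^o) = l.
Proof. by move=> /ccvg_cvg/cvg_lim; apply. Qed.

Definition csum t : R[i] :=
  Complex (limn (series (fun n => cre (t n)))) (limn (series (fun n => cim (t n)))).

Lemma ccvg_csum t v : (forall n, cmod (t n) <= v n) -> cvgn (series v) ->
  ccvg (fun n => \sum_(i < n) t i) (csum t).
Proof.
move=> tv cv.
have cvr : cvgn (series (fun n => cre (t n))).
  apply: normed_cvg; apply: (@series_le_cvg _ _ v) => //= n; rewrite ?normr_ge0//.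
    by rewrite (le_trans _ (tv n))// cmod_ge0.
  by rewrite (le_trans _ (tv n))// norm_cre.
have cvi : cvgn (series (fun n => cim (t n))).
  apply: normed_cvg; apply: (@series_le_cvg _ _ v) => //= n; rewrite ?normr_ge0//.
    by rewrite (le_trans _ (tv n))// cmod_ge0.
  by rewrite (le_trans _ (tv n))// norm_cim.
pose er n := series (fun n => cre (t n)) n - limn (series (fun n => cre (t n))).
pose ei n := series (fun n => cim (t n)) n - limn (series (fun n => cim (t n))).
apply: (@ccvg_le _ _ (fun n => `|er n| + `|ei n|)) => [n|].
  rewrite (le_trans (cmod_le_norm _))// creD cimD creN cimN cre_sum cim_sum.
  by rewrite /er /ei /series/= !big_mkord.
have cer : er n @[n --> \oo] --> 0 by rewrite -(subrr (limn (series (fun n => cre (t n)))));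
  apply: cvgB => //; exact: cvg_cst.
have cei : ei n @[n --> \oo] --> 0 by rewrite -(subrr (limn (series (fun n => cim (t n)))));
  apply: cvgB => //; exact: cvg_cst.
rewrite -[X in _ --> X]addr0 -(normr0 R); apply: cvgD; exact: cvg_norm.
Qed.

End complex_series.

Section even_exponential_series.
Context {R : realType}.
Implicit Types r : R.

Lemma sum_exp_coeff_le r n : 0 <= r -> \sum_(i < n) r ^+ i / i`!%:R <= expR r.
Proof.
move=> r0; rewrite /expR.
have := @nondecreasing_cvgn_le _ (series (exp_coeff r)).
rewrite -(big_mkord xpredT (fun i => r ^+ i / i`!%:R)); apply.
  by apply/nondecreasing_seqP => k; rewrite seriesS lerDr exp_coeff_ge0.
exact: is_cvg_series_exp_coeff.
Qed.

Lemma sum_even_exp_le r n : 0 <= r ->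
  \sum_(i < n) r ^+ (2 * i) / (2 * i)`!%:R <= expR r.
Proof.
move=> r0; apply: le_trans (sum_exp_coeff_le (2 * n) r0).
elim: n => [|n ih]; first by rewrite muln0 !big_ord0.
rewrite (_ : 2 * n.+1 = (2 * n).+2)%N ?mulnS// !big_ord_recr/=.
rewrite -[leRHS]addrA lerD// lerDl.
by rewrite mulr_ge0 ?exprn_ge0 ?invr_ge0.
Qed.

Lemma cvg_even_exp_series r : 0 <= r ->
  cvgn (series (fun i => r ^+ (2 * i) / (2 * i)`!%:R)).
Proof.
move=> r0; apply: nondecreasing_is_cvgn.
  apply/nondecreasing_seqP => k.
  by rewrite seriesS lerDr mulr_ge0 ?exprn_ge0 ?invr_ge0.
exists (expR r) => _ [n _ <-]; rewrite /series/= big_mkord; exact: sum_even_exp_le.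
Qed.

End even_exponential_series.

(** * Normalized Bessel functions *)

Section truncated_exponential.
Context {R : realType}.
Implicit Types (z w : R[i]) (r : R).

Lemma bin_fact_le_exp n m : ('C(n, m) * m`! <= n ^ m)%N.
Proof.
rewrite bin_ffact; elim: m => [|m ih]; first by rewrite ffactn0 expn0.
by rewrite ffactnSr expnSr leq_mul// leq_subr.
Qed.

Lemma bin_div_exp_le (n m : nat) : (0 < n)%N ->
  'C(n, m)%:R / n%:R ^+ m <= (m`!%:R)^-1 :> R.
Proof.
move=> n0; rewrite ler_pdivrMr ?exprn_gt0 ?ltr0n//.
rewrite mulrC ler_pdivlMr ?ltr0n ?fact_gt0//.
by rewrite -natrX -natrM ler_nat bin_fact_le_exp.
Qed.

Lemma exprD1_div (K : fieldType) (z : K) n :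
  (1 + z / n%:R) ^+ n = \sum_(i < n.+1) 'C(n, i)%:R / n%:R ^+ i * z ^+ i.
Proof.
rewrite exprDn; apply: eq_bigr => i _.
by rewrite expr1n mul1r expr_div_n -mulr_natl mulrAC mulrA.
Qed.

(** From exp(-y) >= 1 - y at y = x/(1+x) one gets 1 + x >= exp(x/(1+x)). With x = r/n the n-th power
    has exponent r - r^2/(n+r) >= r - r^2/n, and exp(-r^2/n) >= 1 - r^2/n. *)
Lemma le_exp_compound r n : 0 <= r -> (0 < n)%N ->
  expR r * (1 - r ^+ 2 / n%:R) <= (1 + r / n%:R) ^+ n.
Proof.
move=> r0 n0; have n0' : 0 < n%:R :> R by rewrite ltr0n.
have x0 : 0 <= r / n%:R by rewrite divr_ge0// ltW.
have h : expR ((r / n%:R) / (1 + r / n%:R)) <= 1 + r / n%:R.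
  have p : 0 < 1 + r / n%:R by rewrite ltr_pwDl.
  rewrite -[leRHS]invrK -[leLHS]invrK lef_pV2 ?posrE ?invr_gt0 ?expR_gt0//.
  rewrite -expRN (le_trans _ (expR_ge1Dx _))//.
  by rewrite -[X in X - _](divff (lt0r_neq0 p)) -mulrBl addrK mul1r.
apply: (@le_trans _ _ (expR ((r / n%:R) / (1 + r / n%:R)) ^+ n)); last first.
  by apply: lerXn2r => //; rewrite nnegrE ?expR_ge0// addr_ge0.
rewrite -expRM_natr (_ : _ * n%:R = r - r ^+ 2 / (n%:R + r)); last first.
  by field; rewrite !gt_eqF// ltr_pwDl.
rewrite expRD ler_wpM2l ?expR_ge0//.
apply: le_trans (expR_ge1Dx _); rewrite lerD2l lerN2 ler_wpM2l ?sqr_ge0//.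
by rewrite lef_pV2 ?posrE// ?lerDl// ltr_pwDl.
Qed.

(** |1 + z/n|^2 = 1 + 2 Re z / n + |z|^2 / n^2 is at most the exponential of its excess over 1; half
    of the exponent, times n, is the claimed one. *)
Lemma cmod_compound_le z n : (0 < n)%N ->
  cmod ((1 + z / n%:R) ^+ n) <= expR (cre z + cmod z ^+ 2 / (2 * n%:R)).
Proof.
move=> n0; have n0' : 0 < n%:R :> R by rewrite ltr0n.
set e := cre z / n%:R + cmod z ^+ 2 / (2 * n%:R ^+ 2).
have zn : z / n%:R = (n%:R^-1)%:C%C * z.
  by rewrite mulrC -(rmorph_nat (real_complex R)) -fmorphV.
have h : cmod (1 + z / n%:R) <= expR e.
  rewrite -(@ler_pXn2r _ 2)// ?nnegrE ?cmod_ge0 ?expR_ge0//.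
  rewrite -expRM_natl (le_trans _ (expR_ge1Dx _))//.
  rewrite sqr_cmod zn creD cimD creZ cimZ/= /e sqr_cmod le_eqVlt; apply/orP; left.
  by apply/eqP; field; rewrite gt_eqF.
rewrite cmodX (@le_trans _ _ (expR e ^+ n))//.
  by apply: lerXn2r => //; rewrite nnegrE ?cmod_ge0 ?expR_ge0.
rewrite -expRM_natl ler_expR le_eqVlt; apply/orP; left; apply/eqP.
by rewrite /e; field; rewrite gt_eqF.
Qed.

(* Truncating the exponential series at order n and taking (1 + z/n)^n differ
   by a polynomial with nonnegative coefficients, so the error is largest at
   |z|; this gives |e^z| <= e^(Re z) without a complex exponential. *)
Lemma cmod_truncated_exp z n : (0 < n)%N ->
  cmod (\sum_(i < n.+1) (i`!%:R^-1)%:C%C * z ^+ i) <=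
  expR (cre z + cmod z ^+ 2 / (2 * n%:R)) + expR (cmod z) * (cmod z ^+ 2 / n%:R).
Proof.
move=> n0.
set E := \sum_(i < _) _; set P := (1 + z / n%:R) ^+ n.
rewrite -[E](subrK P) addrC (le_trans (cmodD _ _))// lerD ?cmod_compound_le//.
have -> : E - P = \sum_(i < n.+1)
    ((i`!%:R^-1) - ('C(n, i)%:R / n%:R ^+ i))%:C%C * z ^+ i.
  rewrite /P exprD1_div -sumrB; apply: eq_bigr => i _.
  rewrite -mulrBl real_complexB real_complexM [in RHS](real_complexV (_ ^+ _)).
  by rewrite real_complexX !real_complex_nat.
rewrite (le_trans (cmod_sum _))//.
rewrite (@le_trans _ _ (\sum_(i < n.+1) (cmod z ^+ i / i`!%:R) -
   (1 + cmod z / n%:R) ^+ n))//.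
  rewrite exprD1_div -sumrB ler_sum// => i _.
  rewrite cmodM cmod_real cmodX ger0_norm ?subr_ge0 ?bin_div_exp_le//.
  by rewrite mulrBl [X in _ <= X - _]mulrC.
have := le_exp_compound (cmod_ge0 z) n0.
have := sum_exp_coeff_le n.+1 (cmod_ge0 z).
set S := \sum_(i < _) _; set Q := (1 + _) ^+ n.
set e := expR _; set y := _ / _; lra.
Qed.

(** Euler's formula for the cosine on truncations: the odd powers of iz and -iz cancel, and stopping
    at order 2n keeps exactly the even orders up to 2n. *)
Lemma sum_even_terms z n :
  \sum_(i < n.+1) ((-1) ^+ i / (2 * i)`!%:R)%:C%C * z ^+ (2 * i) =
  2^-1 * (\sum_(i < (2 * n).+1) (i`!%:R^-1)%:C%C * ('i%C * z) ^+ i +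
          \sum_(i < (2 * n).+1) (i`!%:R^-1)%:C%C * (- ('i%C * z)) ^+ i).
Proof.
have sq (w : R[i]) i : w ^+ 2 = - z ^+ 2 ->
    w ^+ (2 * i) = ((-1) ^+ i)%:C%C * z ^+ (2 * i).
  by move=> w2; rewrite real_complexX real_complexN1 !exprM w2 exprNn.
have i2 : ('i%C * z) ^+ 2 = - z ^+ 2 by rewrite exprMn sqr_i mulN1r.
have i2' : (- ('i%C * z)) ^+ 2 = - z ^+ 2 by rewrite sqrrN.
elim: n => [|n ih].
  rewrite muln0 !big_ord1 !expr0 !mulr1 mul1r muln0 fact0 invr1.
  by rewrite -[1%:C%C]/(1 : R[i]); field.
rewrite big_ord_recr/= ih (_ : 2 * n.+1 = (2 * n).+2)%N ?mulnS//.
rewrite [X in _ = 2^-1 * (X + _)]big_ord_recr/= [X in _ = 2^-1 * (X + _ + _)]big_ord_recr/=.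
rewrite [X in _ = 2^-1 * (_ + X)]big_ord_recr/= [X in _ = 2^-1 * (_ + (X + _))]big_ord_recr/=.
have e1 : ('i%C * z) ^+ (2 * n).+2 = ((-1) ^+ n.+1)%:C%C * z ^+ (2 * n).+2.
  by rewrite -[(2 * n).+2]/(2 + 2 * n)%N -mulnS sq.
have e2 : (- ('i%C * z)) ^+ (2 * n).+2 = ((-1) ^+ n.+1)%:C%C * z ^+ (2 * n).+2.
  by rewrite -[(2 * n).+2]/(2 + 2 * n)%N -mulnS (sq _ _ i2').
have e3 : (- ('i%C * z)) ^+ (2 * n).+1 = - ('i%C * z) ^+ (2 * n).+1.
  by rewrite exprNn -signr_odd/= oddM/= expr1 mulN1r.
rewrite e1 e2 e3 real_complexM.
have alg (S1 S2 A B C D Y : R[i]) : 2^-1 * (S1 + S2) + A * B * C =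
    2^-1 * (S1 + D * Y + B * (A * C) + (S2 + D * - Y + B * (A * C))) by field.
exact: alg.
Qed.

(** The exponential bound is applied to iz and -iz, whose real parts are at most |Im z|. The error
    depends on z only through r, so it will be uniform over the points T w with 0 <= T <= 1. *)
Lemma cmod_truncated_cos z n (r : R) : (0 < n)%N -> cmod z <= r ->
  cmod (\sum_(i < n.+1) ((-1) ^+ i / (2 * i)`!%:R)%:C%C * z ^+ (2 * i)) <=
  expR `|cim z| +
  expR r * (expR (r ^+ 2 * (4 * n%:R)^-1) - 1 + r ^+ 2 * (2 * n%:R)^-1).
Proof.
move=> n0 zr; have n0' : 0 < n%:R :> R by rewrite ltr0n.
have r0 : 0 <= r := le_trans (cmod_ge0 z) zr.
have n20 : (0 < 2 * n)%N by rewrite muln_gt0.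
have cmi : cmod ('i%C * z) = cmod z.
  by rewrite cmodM (_ : cmod 'i%C = 1) ?mul1r// cmodE/= expr0n expr1n add0r sqrtr1.
have z2 : cmod z ^+ 2 <= r ^+ 2 by apply: lerXn2r => //; rewrite nnegrE ?cmod_ge0.
have key (w : R[i]) : cmod w = cmod z -> cre w <= `|cim z| ->
    cmod (\sum_(i < (2 * n).+1) (i`!%:R^-1)%:C%C * w ^+ i) <=
    expR `|cim z| +
    expR r * (expR (r ^+ 2 * (4 * n%:R)^-1) - 1 + r ^+ 2 * (2 * n%:R)^-1).
  move=> wz wi; rewrite (le_trans (cmod_truncated_exp w n20))// wz.
  have -> : (2 * n)%:R = 2 * n%:R :> R by rewrite natrM.
  have -> : 2 * (2 * n%:R) = 4 * n%:R :> R by ring.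
  have h1 : expR (cre w + cmod z ^+ 2 / (4 * n%:R)) <=
      expR `|cim z| * expR (r ^+ 2 * (4 * n%:R)^-1).
    by rewrite -expRD ler_expR lerD// ler_wpM2r// invr_ge0 mulr_ge0// ltW.
  have h2 : expR (cmod z) * (cmod z ^+ 2 / (2 * n%:R)) <=
      expR r * (r ^+ 2 * (2 * n%:R)^-1).
    apply: ler_pM; rewrite ?expR_ge0 ?ler_expR//.
      by rewrite divr_ge0 ?sqr_ge0// mulr_ge0// ltW.
    by rewrite ler_wpM2r// invr_ge0 mulr_ge0// ltW.
  (* This product turns the multiplicative error on exp |Im z| into an additive one whose
     coefficient exp r does not involve Im z. *)
  have h3 : 0 <= (expR r - expR `|cim z|) * (expR (r ^+ 2 * (4 * n%:R)^-1) - 1).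
    rewrite mulr_ge0// subr_ge0 ?ler_expR ?(le_trans (norm_cim z))//.
    by rewrite -expR0 ler_expR mulr_ge0 ?sqr_ge0// invr_ge0 mulr_ge0// ltW.
  move: h1 h2 h3; set A := expR (cre w + _); set B := expR (cmod z) * _.
  set D := expR (r ^+ 2 * _); set Y := expR `|_|; set X := expR r.
  set Z := r ^+ 2 * _; lra.
rewrite sum_even_terms cmodM cmodV.
rewrite (_ : cmod 2 = 2); last by rewrite -[2](rmorph_nat (real_complex R)) cmod_real normr_nat.
rewrite mulrC ler_pdivrMr// (le_trans (cmodD _ _))//.
set B := (X in _ <= X * 2); have -> : B * 2 = B + B by ring.
rewrite lerD// key//.
- by rewrite creM/= mul0r mul1r sub0r -normrN ler_norm.
- by rewrite cmodN.
- by rewrite creN creM/= mul0r mul1r sub0r opprK ler_norm.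
Qed.

End truncated_exponential.

(** * Cosine-type series with weights in [0, 1] *)

Section bessel_type_series.
Context {R : realType}.
Implicit Types (M : nat -> R) (z w : R[i]).

Definition unit_seq M := forall m, 0 <= M m <= 1.

(** With all [M m] equal to 1 this is the cosine series. If [M m] are the even moments of a density
    in t, the sum is formally the integral of cos(w t) against it. *)
Definition bessel_term M w (m : nat) : R[i] :=
  ((-1) ^+ m * (M m / (2 * m)`!%:R))%:C%C * w ^+ (2 * m).

Definition bessel_sum M w := csum (bessel_term M w).

Lemma cmod_bessel_term M w m : unit_seq M ->
  cmod (bessel_term M w m) <= cmod w ^+ (2 * m) / (2 * m)`!%:R.
Proof.
move=> /(_ m)/andP[M0 M1]; rewrite cmodM cmodX cmod_real normrM normrX normrN1.
rewrite expr1n mul1r ger0_norm ?divr_ge0// mulrC ler_wpM2l ?exprn_ge0 ?cmod_ge0//.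
by rewrite ler_piMl// invr_ge0.
Qed.

Lemma ccvg_bessel_sum M w : unit_seq M ->
  ccvg (fun n => \sum_(i < n) bessel_term M w i) (bessel_sum M w).
Proof.
move=> uM; apply: (ccvg_csum (fun m => cmod_bessel_term w m uM)).
exact: cvg_even_exp_series (cmod_ge0 w).
Qed.

Lemma cmod_bessel_sum M w : unit_seq M -> cmod (bessel_sum M w) <= expR (cmod w).
Proof.
move=> uM; apply: (ccvg_cmod_le (ccvg_bessel_sum w uM)); last exact: cvg_cst.
move=> n; rewrite (le_trans (cmod_sum _))//.
apply: le_trans (sum_even_exp_le n (cmod_ge0 w)).
by apply: ler_sum => i _; exact: cmod_bessel_term.
Qed.

(* The derivative of the series with moments M is -w times the series with
   these moments. *)
Definition derived_moment M (m : nat) : R := M m.+1 / (2 * m).+1%:R.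

Lemma unit_seq_derived_moment M : unit_seq M -> unit_seq (derived_moment M).
Proof.
move=> uM m; have /andP[M0 M1] := uM m.+1.
rewrite /derived_moment divr_ge0//= ler_pdivrMr// mul1r (le_trans M1)//.
by rewrite ler1n.
Qed.

Lemma ccvg_shift (u : nat -> R[i]) l : ccvg u l -> ccvg (fun n => u n.+1) l.
Proof. by rewrite /ccvg -cvg_shiftS. Qed.

Lemma bessel_term_taylor2 M w h m :
  bessel_term M (w + h) m.+1 - bessel_term M w m.+1
    - h * (- w) * bessel_term (derived_moment M) w m =
  ((-1) ^+ m.+1 * (M m.+1 / (2 * m).+2`!%:R))%:C%C *
  ((w + h) ^+ (2 * m).+2 - w ^+ (2 * m).+2
    - (2 * m).+2%:R * h * w ^+ (2 * m).+1).
Proof.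
rewrite /bessel_term /derived_moment (_ : 2 * m.+1 = (2 * m).+2)%N ?mulnS//.
have f2 : (2 * m).+2`!%:R = (2 * m).+2%:R * ((2 * m).+1%:R * (2 * m)`!%:R) :> R.
  by rewrite !factS !natrM.
have n2 : (2 * m).+2%:R != 0 :> R by rewrite pnatr_eq0.
have n1 : (2 * m).+1%:R != 0 :> R by rewrite pnatr_eq0.
have n0 : (2 * m)`!%:R != 0 :> R by rewrite pnatr_eq0 -lt0n fact_gt0.
have -> : (-1) ^+ m * (M m.+1 / (2 * m).+1%:R / (2 * m)`!%:R) =
    - ((-1) ^+ m.+1 * (M m.+1 / (2 * m).+2`!%:R)) * (2 * m).+2%:R.
  rewrite f2 exprS; move: n2 n1 n0; set x2 := (2 * m).+2%:R; set x1 := (2 * m).+1%:R.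
  set x0 := _`!%:R; clearbody x2 x1 x0 => n2 n1 n0; field.
  by rewrite n0 n1.
set a := _ * (M _ / _); clearbody a.
rewrite real_complexM (_ : (- a)%:C%C = - a%:C%C); last exact: rmorphN.
rewrite real_complex_nat [w ^+ (2 * m).+1]exprS; ring.
Qed.

(** Since (2i+2)(2i+1) / (2i+2)! = 1/(2i)!, the second-order remainders of the terms sum to at most
    |h|^2 times an even exponential series at |w| + |h|. *)
Lemma bessel_sum_taylor2 M w h : unit_seq M ->
  cmod (bessel_sum M (w + h) - bessel_sum M w
        - h * (- w) * bessel_sum (derived_moment M) w) <=
  cmod h ^+ 2 * expR (cmod w + cmod h).
Proof.
move=> uM; have uM' := unit_seq_derived_moment uM.
have r0 : 0 <= cmod w + cmod h by rewrite addr_ge0 ?cmod_ge0.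
have cv := ccvgB (ccvgB (ccvg_shift (ccvg_bessel_sum (w + h) uM))
   (ccvg_shift (ccvg_bessel_sum w uM)))
   (ccvgZ (h * (- w)) (ccvg_bessel_sum w uM')).
apply: (ccvg_cmod_le cv); last exact: cvg_cst.
(* The constant terms at w + h and w cancel; the remaining terms of index i + 1 are paired with the
   terms of index i of the derived series. *)
move=> n /=; rewrite !big_ord_recl/=.
have -> : bessel_term M (w + h) 0 = bessel_term M w 0.
  by rewrite /bessel_term muln0 !expr0.
rewrite [X in X - _](_ : _ =
    \sum_(i < n) (bessel_term M (w + h) i.+1 - bessel_term M w i.+1)); last first.
  rewrite opprD addrACA subrr add0r -sumrB.
  by apply: eq_bigr => i _; rewrite /bump/= add1n.
rewrite mulr_sumr -sumrB (le_trans (cmod_sum _))//.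
apply: le_trans (ler_wpM2l (sqr_ge0 _) (sum_even_exp_le n r0)).
rewrite mulr_sumr; apply: ler_sum => i _; rewrite bessel_term_taylor2.
have /andP[M0 M1] := uM i.+1.
rewrite cmodM cmod_real normrM normrX normrN1 expr1n mul1r ger0_norm ?divr_ge0//.
have f0 : 0 < (2 * i).+2`!%:R :> R by rewrite ltr0n fact_gt0.
have f0' : 0 < (2 * i)`!%:R :> R by rewrite ltr0n fact_gt0.
apply: (@le_trans _ _ ((2 * i).+2`!%:R^-1 *
   (cmod h ^+ 2 * ((2 * i).+2 * (2 * i).+1)%:R * (cmod w + cmod h) ^+ (2 * i)))).
  apply: ler_pM; rewrite ?cmod_ge0 ?divr_ge0 ?pow_taylor2//.
  by rewrite ler_piMl// invr_ge0 ltW.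
rewrite le_eqVlt; apply/orP; left; apply/eqP.
have -> : (2 * i).+2`!%:R = ((2 * i).+2 * (2 * i).+1)%:R * (2 * i)`!%:R :> R.
  by rewrite -natrM -mulnA !factS.
have p0 : ((2 * i).+2 * (2 * i).+1)%:R != 0 :> R by rewrite pnatr_eq0.
move: p0 f0'; set x := (_ * _)%:R; set y := _`!%:R; clearbody x y => p0 f0'.
by field; rewrite p0 gt_eqF.
Qed.

End bessel_type_series.

(** * Series whose coefficients are moments on [0, 1] *)

Section integral_representation.
Context {R : realType}.
Local Notation mu := (@lebesgue_measure R).
Implicit Types (M : nat -> R) (f omega T : R -> R) (w : R[i]).

(** Continuity as a function on R at every point of [0, 1], endpoints included: the pointwise limit
    rules apply directly, and continuity on the closed interval follows. *)
Definition cont01 f := forall v, 0 <= v <= 1 -> {for v, continuous f}.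

Lemma cont01_cst (c : R) : cont01 (cst c).
Proof. by move=> v _; exact: cvg_cst. Qed.

Lemma cont01M f g : cont01 f -> cont01 g -> cont01 (fun v => f v * g v).
Proof. by move=> cf cg v v01; apply: cvgM; [exact: cf|exact: cg]. Qed.

Lemma cont01D f g : cont01 f -> cont01 g -> cont01 (fun v => f v + g v).
Proof. by move=> cf cg v v01; apply: cvgD; [exact: cf|exact: cg]. Qed.

Lemma cont01B f g : cont01 f -> cont01 g -> cont01 (fun v => f v - g v).
Proof. by move=> cf cg v v01; apply: cvgB; [exact: cf|exact: cg]. Qed.

Lemma cont01X f n : cont01 f -> cont01 (fun v => f v ^+ n).
Proof.
move=> cf; elim: n => [|n ih].
  by under eq_fun do rewrite expr0; exact: cont01_cst.
by under eq_fun do rewrite exprS; exact: cont01M.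
Qed.

Lemma cont01_comp f (g : R -> R) : cont01 f ->
  (forall v, 0 <= v <= 1 -> {for f v, continuous g}) -> cont01 (fun v => g (f v)).
Proof.
move=> cf cg v v01.
by apply: (@continuous_comp _ _ _ f g); [exact: cf|exact: cg].
Qed.

Lemma cont01_within f : cont01 f -> {within `[0, 1], continuous f}.
Proof.
by move=> cf; apply: continuous_in_subspaceT => v; rewrite inE/= in_itv/=; exact: cf.
Qed.

Lemma cont01_integrable f : cont01 f -> mu.-integrable `[0%R, 1%R] (EFin \o f).
Proof.
move=> cf; apply: continuous_compact_integrable; first exact: segment_compact.
exact: cont01_within.
Qed.

Local Notation int01 f := (Rintegral mu `[0%R, 1%R] f).

Lemma le_int01 f g : cont01 f -> cont01 g ->
  (forall v, 0 <= v <= 1 -> f v <= g v) -> int01 f <= int01 g.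
Proof.
move=> cf cg fg; apply: le_Rintegral => //.
- exact: cont01_integrable.
- exact: cont01_integrable.
Qed.

Lemma int01D f g : cont01 f -> cont01 g ->
  int01 (fun v => f v + g v) = int01 f + int01 g.
Proof. by move=> cf cg; rewrite RintegralD//; exact: cont01_integrable. Qed.

Lemma int01Z f (c : R) : cont01 f -> int01 (fun v => c * f v) = c * int01 f.
Proof. by move=> cf; rewrite RintegralZl//; exact: cont01_integrable. Qed.

Lemma int01_sum n (a : nat -> R) (g : nat -> R -> R) : (forall i, cont01 (g i)) ->
  int01 (fun v => \sum_(i < n) a i * g i v) = \sum_(i < n) a i * int01 (g i).
Proof.
move=> cg; have cs m : cont01 (fun v => \sum_(i < m) a i * g i v).
  elim: m => [|m ih].
    by under eq_fun do rewrite big_ord0; exact: cont01_cst.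
  under eq_fun do rewrite big_ord_recr/=; apply: cont01D => //.
  by apply: cont01M => //; exact: cont01_cst.
elim: n => [|n ih].
  have -> : (fun v => \sum_(i < 0) a i * g i v) = cst 0.
    by apply/funext => v; rewrite big_ord0.
  by rewrite big_ord0 Rintegral_cst// mul0r.
have -> : (fun v => \sum_(i < n.+1) a i * g i v) =
    (fun v => \sum_(i < n) a i * g i v + a n * g n v).
  by apply/funext => v; rewrite big_ord_recr.
rewrite big_ord_recr/= int01D ?ih ?int01Z//; first exact: cs.
by apply: cont01M => //; exact: cont01_cst.
Qed.

Lemma int01_gt0 f (c : R) : cont01 f -> 0 < c ->
  (forall v, 0 <= v <= 1 -> c <= f v) -> 0 < int01 f.
Proof.
move=> cf c0 cfv; apply: (@lt_le_trans _ _ (int01 (cst c))); last first.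
  by apply: le_int01 => //; exact: cont01_cst.
rewrite Rintegral_cst//= lebesgue_measure_itv/= lte_fin ltr01/=.
by rewrite oppr0 addr0 mulr1.
Qed.

Lemma cvg_cos_error (r : R) :
  expR r * (expR (r ^+ 2 * (4 * n.+1%:R)^-1) - 1 + r ^+ 2 * (2 * n.+1%:R)^-1)
    @[n --> \oo] --> 0.
Proof.
have h (c : R) : c != 0 -> r ^+ 2 * (c * n.+1%:R)^-1 @[n --> \oo] --> 0.
  move=> c0; rewrite -(mulr0 (r ^+ 2)); apply: cvgM; first exact: cvg_cst.
  under eq_fun do rewrite invfM; rewrite -(mulr0 c^-1).
  by apply: cvgM; [exact: cvg_cst|exact: cvg_harmonic].
rewrite -[X in _ --> X](mulr0 (expR r)); apply: cvgM; first exact: cvg_cst.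
rewrite -[X in _ --> X](addr0 0); apply: cvgD; last exact: h.
rewrite -[X in _ --> X](subrr 1); apply: cvgB; last exact: cvg_cst.
rewrite -[X in _ --> X]expR0; apply: continuous_cvg; first exact: continuous_expR.
exact: h.
Qed.

(** A partial sum is the integral of omega(v) times the truncated cosine at T(v) w. The latter is
    bounded by exp(T(v) |Im w|) plus an error that is uniform in v because |T(v) w| <= |w|; this
    error vanishes in the limit. The projections on unit directions keep every integral real. *)
Lemma cmod_bessel_sum_le M omega T w : unit_seq M -> cont01 omega -> cont01 T ->
  (forall v, 0 <= v <= 1 -> 0 <= omega v) ->
  (forall v, 0 <= v <= 1 -> 0 <= T v <= 1) ->
  (forall m, M m = int01 (fun v => omega v * T v ^+ (2 * m))) ->
  cmod (bessel_sum M w) <= int01 (fun v => omega v * expR (`|cim w| * T v)).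
Proof.
move=> uM co cT o0 T01 ME; set I := int01 _.
pose er n := expR (cmod w) * (expR (cmod w ^+ 2 * (4 * n.+1%:R)^-1) - 1
   + cmod w ^+ 2 * (2 * n.+1%:R)^-1).
(* After two shifts the sum has n + 2 terms, that is, truncation order n + 1, which is positive as
   the error bound requires. *)
have cv := ccvg_shift (ccvg_shift (ccvg_bessel_sum w uM)).
apply: (@ccvg_cmod_le _ _ _ (fun n => I + er n * M 0) _ cv); last first.
  rewrite -[X in _ --> X]addr0; apply: cvgD; first exact: cvg_cst.
  rewrite -(mul0r (M 0)); apply: cvgM; last exact: cvg_cst.
  exact: cvg_cos_error.
move=> n /=; apply: cmod_le_dual => c s cs.
pose a i := (-1) ^+ i / (2 * i)`!%:R * (c * cre (w ^+ (2 * i)) + s * cim (w ^+ (2 * i))).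
have cg i : cont01 (fun v => omega v * T v ^+ (2 * i)).
  by apply: cont01M => //; exact: cont01X.
have -> : c * cre (\sum_(i < n.+2) bessel_term M w i) +
    s * cim (\sum_(i < n.+2) bessel_term M w i) =
    int01 (fun v => \sum_(i < n.+2) a i * (omega v * T v ^+ (2 * i))).
  rewrite (int01_sum _ a (g := fun i v => omega v * T v ^+ (2 * i)))//.
  rewrite cre_sum cim_sum !mulr_sumr -big_split/=.
  by apply: eq_bigr => i _; rewrite -ME /bessel_term creZ cimZ /a; ring.
have cexp : cont01 (fun v => omega v * expR (`|cim w| * T v)).
  apply: cont01M => //; apply: cont01_comp.
    by apply: cont01M => //; exact: cont01_cst.
  by move=> v _; exact: continuous_expR.
have M0E : M 0 = int01 omega.
  rewrite ME; congr Rintegral; apply/funext => v.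
  by rewrite muln0 expr0 mulr1.
rewrite M0E -int01Z// -int01D//; last by apply: cont01M => //; exact: cont01_cst.
apply: le_int01 => //.
- elim: (n.+2) => [|m ih].
    by under eq_fun do rewrite big_ord0; exact: cont01_cst.
  under eq_fun do rewrite big_ord_recr/=; apply: cont01D => //.
  by apply: cont01M => //; exact: cont01_cst.
- by apply: cont01D => //; apply: cont01M => //; exact: cont01_cst.
move=> v v01; have /andP[t0 t1] := T01 v v01.
have -> : \sum_(i < n.+2) a i * (omega v * T v ^+ (2 * i)) =
    omega v * (c * cre (\sum_(i < n.+2) ((-1) ^+ i / (2 * i)`!%:R)%:C%C *
                          ((T v)%:C%C * w) ^+ (2 * i)) +
               s * cim (\sum_(i < n.+2) ((-1) ^+ i / (2 * i)`!%:R)%:C%C *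
                          ((T v)%:C%C * w) ^+ (2 * i))).
  rewrite cre_sum cim_sum !mulr_sumr -big_split/= mulr_sumr.
  apply: eq_bigr => i _; rewrite exprMn -real_complexX !creZ !cimZ /a; ring.
rewrite [X in _ <= _ + X]mulrC -mulrDr ler_wpM2l ?o0//.
apply: le_trans (dual_le_cmod _ cs) _.
have cTw : cmod ((T v)%:C%C * w) <= cmod w.
  by rewrite cmodM cmod_real ger0_norm// ler_piMl// cmod_ge0.
apply: le_trans (cmod_truncated_cos (ltn0Sn n) cTw) _.
by rewrite cimZ normrM (ger0_norm t0) [T v * _]mulrC.
Qed.

End integral_representation.

(** * The moments of the Bessel function and its decay *)

Section bessel_moments.
Context {R : realType}.
Local Notation mu := (@lebesgue_measure R).
Local Notation int01 f := (Rintegral mu `[0%R, 1%R] f).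
Implicit Types (beta g v : R).

(** The coefficient of (-1)^m w^(2m) / (2m)! in j; the power of 4 comes from (w/2)^(2m). *)
Definition bessel_moment beta (m : nat) : R :=
  (2 * m)`!%:R * Gamma (beta + 1) / (m`!%:R * Gamma (beta + m%:R + 1) * 4 ^+ m).

Lemma bessel_moment0 beta : 0 < beta + 1 -> bessel_moment beta 0 = 1.
Proof.
move=> b0; rewrite /bessel_moment muln0 fact0 !mul1r addr0 expr0 mulr1 divff//.
by rewrite gt_eqF// Gamma_gt0.
Qed.

Lemma bessel_momentS beta m : 0 < beta + 1 ->
  bessel_moment beta m.+1 * (2 * (beta + m%:R + 1)) =
  bessel_moment beta m * (2 * m%:R + 1).
Proof.
move=> b0; have bm0 : 0 < beta + m%:R + 1 by rewrite addrAC ltr_pwDl.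
have G0 : 0 < Gamma (beta + m%:R + 1) by exact: Gamma_gt0.
rewrite /bessel_moment (_ : beta + m.+1%:R + 1 = beta + m%:R + 1 + 1); last first.
  by rewrite -natr1; ring.
rewrite (GammaS bm0) (_ : 2 * m.+1 = (2 * m).+2)%N ?mulnS// !factS !natrM exprS.
have -> : (2 * m).+2%:R = 2 * m%:R + 2 :> R by rewrite -addn2 natrD natrM.
have -> : (2 * m).+1%:R = 2 * m%:R + 1 :> R by rewrite -addn1 natrD natrM.
have -> : m.+1%:R = m%:R + 1 :> R by rewrite natr1.
have f0 : 0 < m`!%:R :> R by rewrite ltr0n fact_gt0.
have p0 : 0 < 4 ^+ m :> R by rewrite exprn_gt0.
have m0 : 0 < m%:R + 1 :> R by rewrite ltr_wpDl.
move: (Gamma (beta + 1)) (Gamma _) (4 ^+ m) (m`!%:R) ((2 * m)`!%:R) (m%:R) G0 f0 p0 m0 bm0.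
move=> A B C D E k G0 f0 p0 m0 bm0; field.
by rewrite !gt_eqF.
Qed.

(** The moments start at 1 and have ratios (2m+1) / (2m + 2 beta + 2), which lie in [0, 1] because
    beta >= -1/2. *)
Lemma unit_seq_bessel_moment beta : - 2^-1 <= beta -> unit_seq (bessel_moment beta).
Proof.
move=> b12; have b0 : 0 < beta + 1 by lra.
elim=> [|m /andP[M0 M1]]; first by rewrite bessel_moment0// ler01 lexx.
have m0 : 0 <= m%:R :> R by [].
have d0 : 0 < 2 * (beta + m%:R + 1) by lra.
have -> : bessel_moment beta m.+1 =
    bessel_moment beta m * ((2 * m%:R + 1) / (2 * (beta + m%:R + 1))).
  by rewrite mulrA -bessel_momentS// mulfK// gt_eqF.
have q1 : (2 * m%:R + 1) / (2 * (beta + m%:R + 1)) <= 1.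
  by rewrite ler_pdivrMr//; lra.
have q0 : 0 <= (2 * m%:R + 1) / (2 * (beta + m%:R + 1)).
  by rewrite divr_ge0//; lra.
by rewrite mulr_ge0//= mulr_ile1.
Qed.

Lemma jbesselE beta (w : R[i]) : - 2^-1 <= beta ->
  jbessel beta w = bessel_sum (bessel_moment beta) w.
Proof.
move=> b12; have b0 : 0 < beta + 1 by lra.
have uM := unit_seq_bessel_moment b12.
rewrite /jbessel (_ : series _ =
    fun n => \sum_(i < n) bessel_term (bessel_moment beta) w i).
  exact: ccvg_limn (ccvg_bessel_sum w uM).
apply/funext => n; rewrite /series/= big_mkord; apply: eq_bigr => i _.
rewrite /bessel_term expr_div_n mulrCA -real_complex_nat -real_complexX.
rewrite -real_complexV [in RHS]mulrC -real_complexM; congr (_ * _%:C%C).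
have bi0 : 0 < beta + i%:R + 1 by rewrite addrAC ltr_pwDl.
have G0 : 0 < Gamma (beta + i%:R + 1) by exact: Gamma_gt0.
have f0 : 0 < i`!%:R :> R by rewrite ltr0n fact_gt0.
have f1 : 0 < (2 * i)`!%:R :> R by rewrite ltr0n fact_gt0.
rewrite /bessel_moment exprM (_ : 2 ^+ 2 = 4 :> R); last by ring.
have p0 : 0 < 4 ^+ i :> R by rewrite exprn_gt0.
move: (Gamma (beta + 1)) (Gamma _) (4 ^+ i) (i`!%:R) ((2 * i)`!%:R) ((-1) ^+ i) G0 f0 f1 p0.
move=> A B C D E k G0 f0 f1 p0; field.
by rewrite !gt_eqF.
Qed.

(* Substituting v = (1 - t)^g in the Poisson integral
   int_0^1 (1 - t^2)^(g - 1) cos(w t) dt removes its singularity at t = 1;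
   poisson_node is t as a function of v. The maximum only serves to make the
   function continuous at v = 0. *)
Definition poisson_node g v : R := 1 - (Num.max v 0) `^ g^-1.
(** What remains of (1 - t^2)^(g-1) once dv, proportional to (1 - t)^(g-1) dt, has absorbed the
    singular factor. *)
Definition poisson_weight g v : R := (1 + poisson_node g v) `^ (g - 1).

Lemma poisson_nodeE g v : 0 <= v -> poisson_node g v = 1 - v `^ g^-1.
Proof. by move=> v0; rewrite /poisson_node (max_idPl v0). Qed.

Lemma poisson_node01 g v : 0 < g -> 0 <= v <= 1 -> 0 <= poisson_node g v <= 1.
Proof.
move=> g0 /andP[v0 v1]; rewrite poisson_nodeE// subr_ge0 gerBl powR_ge0 andbT.
have <- : 1 `^ g^-1 = 1 :> R by rewrite powR1.
by apply: ge0_ler_powR; rewrite ?nnegrE ?invr_ge0 ?(ltW g0).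
Qed.

Lemma continuous_max0_powR (q : R) : 0 < q ->
  continuous (fun v : R => (Num.max v 0) `^ q).
Proof.
move=> q0 x; have [x0|x0|->] := ltgtP x 0.
- apply/cvgrPdist_lt => e e0; near=> v.
  have v0 : v < 0 by near: v; exact: lt_nbhsl.
  rewrite (max_idPr (ltW x0)) (max_idPr (ltW v0)) subrr normr0//.
- apply: (@cvg_trans _ (v `^ q @[v --> x])); last first.
    by rewrite /= (max_idPl (ltW x0)); exact: continuous_powR_pos.
  apply: near_eq_cvg; near=> v.
  have v0 : 0 < v by near: v; exact: lt_nbhsr.
  by rewrite (max_idPl (ltW v0)).
- have m0 : Num.max 0 0 `^ q = 0 :> R by rewrite maxxx powR0// gt_eqF.
  apply/cvgrPdist_lt => e e0; near=> v; rewrite /= m0 sub0r normrN ger0_norm ?powR_ge0//.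
  have [v0|v0] := leP v 0.
    by rewrite powR0 ?gt_eqF.
  have -> : e = (e `^ q^-1) `^ q.
    by rewrite -powRrM mulVf ?gt_eqF// powRr1 ?ltW.
  apply: gt0_ltr_powR => //; rewrite ?nnegrE ?powR_ge0 ?(ltW v0)//.
  near: v; apply: lt_nbhsl; exact: powR_gt0.
Unshelve. all: by end_near. Qed.

Lemma cont01_poisson_node g : 0 < g -> cont01 (poisson_node g).
Proof.
move=> g0; apply: cont01B; first exact: cont01_cst.
by move=> v _; apply: continuous_max0_powR; rewrite invr_gt0.
Qed.

Lemma cont01_poisson_pow g (s : R) : 0 < g ->
  cont01 (fun v => (1 + poisson_node g v) `^ s).
Proof.
move=> g0; apply: (@cont01_comp _ (fun v => 1 + poisson_node g v) (fun x => x `^ s)).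
  by apply: cont01D; [exact: cont01_cst|exact: cont01_poisson_node].
move=> v /(poisson_node01 g0)/andP[t0 _]; apply: continuous_powR_pos.
by rewrite ltr_pwDl.
Qed.

Definition poisson_moment g (m : nat) : R :=
  int01 (fun v => poisson_weight g v * poisson_node g v ^+ (2 * m)).

Lemma cont01_poisson_integrand g m : 0 < g ->
  cont01 (fun v => poisson_weight g v * poisson_node g v ^+ m).
Proof.
move=> g0; apply: cont01M; first exact: cont01_poisson_pow.
by apply: cont01X; exact: cont01_poisson_node.
Qed.

Lemma poisson_weight_ge g v : 0 < g -> 0 <= v <= 1 ->
  2^-1 <= poisson_weight g v.
Proof.
move=> g0 /(poisson_node01 g0)/andP[t0 t1].
have p1 : 1 <= 1 + poisson_node g v by rewrite lerDl.
apply: (@le_trans _ _ ((1 + poisson_node g v) `^ (-1))).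
  have p0 : 0 < 1 + poisson_node g v by exact: lt_le_trans p1.
  by rewrite powR_inv1 ?(ltW p0)// lef_pV2 ?posrE//; lra.
by apply: ler_powR => //; lra.
Qed.

Lemma poisson_moment0_gt0 g : 0 < g -> 0 < poisson_moment g 0.
Proof.
move=> g0; apply: (@int01_gt0 _ _ 2^-1); first exact: cont01_poisson_integrand.
  by [].
by move=> v v01; rewrite muln0 expr0 mulr1 poisson_weight_ge.
Qed.

Lemma is_derive_poisson_node g v : 0 < g -> 0 < v ->
  is_derive v 1 (poisson_node g) (- (g^-1 * v `^ (g^-1 - 1))).
Proof.
move=> g0 v0.
have d1 : is_derive v 1 (fun v => 1 - v `^ g^-1) (- (g^-1 * v `^ (g^-1 - 1))).
  rewrite -[X in is_derive _ _ _ X]add0r.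
  exact: is_deriveB (is_derive_cst _ _ _) (is_derive1_powR _ v0).
have e : {near v, (fun v => 1 - v `^ g^-1) =1 poisson_node g}.
  near=> x; have x0 : 0 < x by near: x; exact: lt_nbhsr.
  by rewrite poisson_nodeE// ltW.
exact: near_eq_is_derive d1.
Unshelve. all: by end_near. Qed.

(** Integration by parts with F = (1 - t^2)^g t^(2m+1), written in the variable v. It vanishes at
    both ends: at v = 0 through the factor v, at v = 1 because t = 0 there. The relation v T'(v) =
    -(1 - T(v)) / g expresses F' through T alone, so it stays continuous at v = 0. *)
Lemma poisson_momentS g m : 0 < g ->
  poisson_moment g m.+1 * (2 * g + 2 * m%:R + 1) =
  poisson_moment g m * (2 * m%:R + 1).
Proof.
move=> g0; pose T := poisson_node g; pose W := poisson_weight g.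
pose F v := v * ((1 + T v) `^ g * T v ^+ (2 * m).+1).
pose f v := (2 + (2 * m%:R + 1) / g) * (W v * T v ^+ (2 * m.+1)) -
   (2 * m%:R + 1) / g * (W v * T v ^+ (2 * m)).
have c1 k : cont01 (fun v => W v * T v ^+ k) by exact: cont01_poisson_integrand.
have c2 (a : R) k : cont01 (fun v => a * (W v * T v ^+ k)).
  by apply: cont01M => //; exact: cont01_cst.
have cF : cont01 F.
  apply: cont01M; first by move=> v _; exact: cvg_id.
  apply: cont01M; first exact: cont01_poisson_pow.
  by apply: cont01X; exact: cont01_poisson_node.
have cf : cont01 f by exact: cont01B.
have dF v : 0 < v < 1 -> is_derive v 1 F (f v).
  move=> /andP[v0 v1].
  have /andP[t0 t1] : 0 <= T v <= 1 by rewrite poisson_node01// !ltW.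
  have dT := is_derive_poisson_node g0 v0.
  have p0 : 0 < 1 + T v by rewrite ltr_pwDl.
  have d1T : is_derive v 1 (fun v => 1 + T v) (- (g^-1 * v `^ (g^-1 - 1))).
    rewrite -[X in is_derive _ _ _ X]add0r.
    exact: is_deriveD (is_derive_cst _ _ _) dT.
  have dp := @is_derive1_comp R (fun x => x `^ g) (fun v => 1 + T v) v _ _
    (is_derive1_powR g p0) d1T.
  have dX := is_deriveX (2 * m).+1 dT.
  have dFv := is_deriveM (is_derive_id v 1) (is_deriveM dp dX).
  have -> : F = (id * (((fun x => x `^ g) \o (fun v => 1 + T v)) *
      T ^+ (2 * m).+1)).
    by apply/funext => x; rewrite /F !mulrfctE exprfctE.
  apply: (is_derive_eq dFv).
  rewrite !mulrfctE exprfctE /GRing.scale/= /f /W /poisson_weight -/(T v).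
  have pg := powR_posB1 g p0.
  have hv : v `^ (g^-1 - 1) = (1 - T v) / v.
    apply: (mulfI (lt0r_neq0 v0)); rewrite powR_posB1// mulrCA divff ?lt0r_neq0//.
    by rewrite mulr1 /T poisson_nodeE ?(ltW v0)// opprB addrC subrK.
  rewrite -pg hv (_ : 2 * m.+1 = (2 * m).+2)%N ?mulnS//.
  rewrite ![T v ^+ (_.+1)]exprS -[(2 * m).+1%:R]natr1 natrM.
  have {}g0 := lt0r_neq0 g0; have {}v0 := lt0r_neq0 v0.
  move: (T v ^+ (2 * m)) (T v) ((1 + T v) `^ _) m%:R => t2 t P k.
  by field; rewrite g0 v0.
have If : int01 f = 0.
  rewrite /Rintegral (@continuous_FTC2 _ f F 0 1)//.
  - rewrite /F mul0r mul1r [T 1]/T poisson_nodeE// powR1 subrr exprS mul0r mulr0.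
    by rewrite -EFinB subr0.
  - exact: cont01_within.
  - split.
    + by move=> v; rewrite in_itv/= => /dF[].
    + by apply: cvg_at_right_filter; apply: cF; rewrite lexx ler01.
    + by apply: cvg_at_left_filter; apply: cF; rewrite lexx ler01.
  - by move=> v; rewrite in_itv/= => /dF[_ <-]; rewrite derive1E.
move: If; rewrite /f RintegralB//; [|exact: cont01_integrable..].
rewrite !int01Z//; rewrite -/(poisson_moment g m) -/(poisson_moment g m.+1).
move: (poisson_moment g m) (poisson_moment g m.+1) => G G' /eqP.
rewrite subr_eq0 => /eqP e.
have {}g0 := lt0r_neq0 g0.
transitivity (g * ((2 + (2 * m%:R + 1) / g) * G')); first by field.
by rewrite e; field.
Qed.

(** Both sides have value 1 at m = 0 and satisfy the same first-order recurrence, as 2 g + 2 m + 1 =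
    2 (beta + m + 1) for g = beta + 1/2. *)
Lemma bessel_moment_poisson beta m : 0 < beta + 2^-1 ->
  bessel_moment beta m =
  poisson_moment (beta + 2^-1) m / poisson_moment (beta + 2^-1) 0.
Proof.
move=> g0; have b0 : 0 < beta + 1 by lra.
have G0 := poisson_moment0_gt0 g0.
elim: m => [|m ih]; first by rewrite bessel_moment0// divff// gt_eqF.
have m0 : 0 <= m%:R :> R by [].
have d0 : 2 * (beta + m%:R + 1) != 0 by rewrite gt_eqF//; lra.
apply: (mulIf d0); rewrite bessel_momentS// ih mulrAC -poisson_momentS// mulrAC.
congr (_ * _); lra.
Qed.

(** The source of the decay factor, used with Y = y^g; a primitive is v / (1 + Y v). *)
Lemma int01_inv_sqr (Y : R) : 0 <= Y ->
  int01 (fun v => ((1 + Y * v) ^+ 2)^-1) = (1 + Y)^-1.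
Proof.
move=> Y0.
have p v : 0 <= v <= 1 -> 0 < 1 + Y * v.
  by move=> /andP[v0 _]; rewrite ltr_pwDl// mulr_ge0.
rewrite /Rintegral (@integral_is_derive _ _ (fun v => v * (1 + Y * v)^-1))//.
- by rewrite /= mul0r mulr1 mul1r subr0.
- move=> v; rewrite in_itv/= => /p v0.
  apply: cvgV; first by rewrite sqrf_eq0 gt_eqF.
  apply: (@continuous_comp _ _ _ (fun v : R => 1 + Y * v) (fun y : R => y ^+ 2)).
    by apply: cvgD; [exact: cvg_cst|apply: cvgM; [exact: cvg_cst|exact: cvg_id]].
  exact: exprn_continuous.
- move=> v; rewrite in_itv/= => /p v0.
  have d1 : is_derive v 1 (fun v => 1 + Y * v) Y.
    have := is_deriveD (is_derive_cst (1 : R) v 1) (is_deriveZ Y (is_derive_id v 1)).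
    by move=> d; apply: (is_derive_eq d); rewrite add0r /GRing.scale/= mulr1.
  have n0 := lt0r_neq0 v0.
  have d2 := @is_deriveV _ (fun v => 1 + Y * v) _ _ _ n0 d1.
  have d3 := is_deriveM (is_derive_id v 1) d2.
  apply: (is_derive_eq d3); rewrite /GRing.scale/=; by field.
Qed.

(** As t = 1 - v^(1/g), exp(y t) = exp(y) exp(-x) with x = y v^(1/g) and x^g = y^g v. Hence exp(-x)
    <= C / (1 + y^g v)^2, whose integral over [0, 1] is C / (1 + y^g). *)
Lemma int01_exp_poisson_le g : 0 < g -> exists2 K, 0 < K &
  forall y : R, 0 <= y ->
  int01 (fun v => poisson_weight g v * expR (y * poisson_node g v)) <=
  K * expR y / (1 + y `^ g).
Proof.
move=> g0; have [C C0 hC] := sqr1DpowR_le_expR (ltW g0).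
exists (2 `^ g * C) => [|y y0]; first by rewrite mulr_gt0// powR_gt0.
have Y0 : 0 <= y `^ g by exact: powR_ge0.
rewrite -(int01_inv_sqr Y0).
have cI : cont01 (fun v => ((1 + y `^ g * v) ^+ 2)^-1).
  move=> v /andP[v0 v1]; apply: cvgV.
    by rewrite sqrf_eq0 gt_eqF// ltr_pwDl// mulr_ge0.
  apply: (@continuous_comp _ _ _ (fun v : R => 1 + y `^ g * v) (fun y : R => y ^+ 2)).
    by apply: cvgD; [exact: cvg_cst|apply: cvgM; [exact: cvg_cst|exact: cvg_id]].
  exact: exprn_continuous.
rewrite -int01Z//; apply: le_int01.
- apply: cont01M; first exact: cont01_poisson_pow.
  apply: (@cont01_comp _ (fun v => y * poisson_node g v) expR).
    by apply: cont01M; [exact: cont01_cst|exact: cont01_poisson_node].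
  by move=> v _; exact: continuous_expR.
- by apply: cont01M => //; exact: cont01_cst.
move=> v v01; have /andP[t0 t1] := poisson_node01 g0 v01.
have /andP[v0 v1] := v01.
(* Passing through the exponent g treats g < 1 and g >= 1 at once. *)
have W2 : poisson_weight g v <= 2 `^ g.
  apply: (@le_trans _ _ ((1 + poisson_node g v) `^ g)).
    by apply: ler_powR; lra.
  by apply: ge0_ler_powR; rewrite ?nnegrE ?(ltW g0)//; lra.
have x0 : 0 <= y * v `^ g^-1 by rewrite mulr_ge0 ?powR_ge0.
have := hC _ x0; rewrite powRM ?powR_ge0// -powRrM mulVf ?gt_eqF// powRr1// => h.
have q0 : 0 < (1 + y `^ g * v) ^+ 2 by rewrite exprn_gt0// ltr_pwDl// mulr_ge0.
rewrite -!mulrA; apply: ler_pM => //; rewrite ?powR_ge0 ?expR_ge0//.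
rewrite mulrA ler_pdivlMr// poisson_nodeE// mulrBr mulr1 expRB.
rewrite mulrAC ler_pdivrMr ?expR_gt0// [C * _]mulrC -mulrA.
by rewrite ler_pM2l ?expR_gt0.
Qed.

Lemma jbessel_decay beta : - 2^-1 <= beta -> exists2 K, 0 < K &
  forall w : R[i], cmod (jbessel beta w) <=
    K * expR `|cim w| / (1 + `|cim w| `^ (beta + 2^-1)).
Proof.
move=> b12; have uM := unit_seq_bessel_moment b12.
have [g0|g0] := ltP 0 (beta + 2^-1).
  have G0 := poisson_moment0_gt0 g0.
  set g := beta + 2^-1 in g0 G0 *; set G := poisson_moment g 0 in G0.
  have [K K0 hK] := int01_exp_poisson_le g0.
  exists (G^-1 * K) => [|w]; first by rewrite mulr_gt0// invr_gt0.
  have cW : cont01 (poisson_weight g) by exact: cont01_poisson_pow.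
  rewrite jbesselE//.
  have h := @cmod_bessel_sum_le _ _ (fun v => G^-1 * poisson_weight g v)
    (poisson_node g) w uM.
  apply: le_trans (h _ _ _ _ _) _.
  - by apply: cont01M => //; exact: cont01_cst.
  - exact: cont01_poisson_node.
  - by move=> v _; rewrite mulr_ge0 ?powR_ge0// invr_ge0 ltW.
  - by move=> v; exact: poisson_node01.
  - move=> m; rewrite bessel_moment_poisson// -/g -/G mulrC /poisson_moment.
    rewrite -int01Z; last exact: cont01_poisson_integrand.
    by congr Rintegral; apply/funext => v; rewrite mulrA.
  rewrite (_ : (fun v => _) = (fun v => G^-1 * (poisson_weight g v *
      expR (`|cim w| * poisson_node g v)))); last first.
    by apply/funext => v; rewrite mulrA.
  rewrite int01Z; last first.
    apply: cont01M => //.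
    apply: (@cont01_comp _ (fun v => `|cim w| * poisson_node g v) expR).
      by apply: cont01M; [exact: cont01_cst|exact: cont01_poisson_node].
    by move=> v _; exact: continuous_expR.
  by rewrite -!mulrA ler_pM2l ?invr_gt0// mulrA hK.
(* The cosine case g = 0: all moments equal 1, the measure is replaced by constant functions on
   [0, 1], and K = 2 compensates 1 + |Im w|^0 = 2. *)
have bE : beta = - 2^-1 by lra.
exists 2 => // w; rewrite jbesselE//.
have M1 m : bessel_moment beta m = 1.
  have b0 : 0 < beta + 1 by rewrite bE; lra.
  elim: m => [|m ih]; first exact: bessel_moment0.
  have m0 : 0 <= m%:R :> R by [].
  have d0 : 2 * (beta + m%:R + 1) != 0 by rewrite gt_eqF//; lra.
  by apply: (mulIf d0); rewrite bessel_momentS// ih bE; lra.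
have h := @cmod_bessel_sum_le _ _ (cst 1) (cst 1) w uM.
apply: le_trans (h _ _ _ _ _) _.
- exact: cont01_cst.
- exact: cont01_cst.
- by move=> v _ /=; exact: ler01.
- by move=> v _ /=; rewrite ler01 lexx.
- move=> m; rewrite M1 (_ : (fun v => _) = cst 1); last first.
    by apply/funext => v; rewrite /= expr1n mulr1.
  by rewrite Rintegral_cst//= lebesgue_measure_itv/= lte_fin ltr01/= oppr0 addr0 mulr1.
rewrite (_ : (fun v => _) = cst (expR `|cim w|)); last first.
  by apply/funext => v; rewrite /= mulr1 mul1r.
rewrite Rintegral_cst//= lebesgue_measure_itv/= lte_fin ltr01/= oppr0 addr0 mulr1.
rewrite bE addNr powRr0 (_ : 2 * _ / _ = expR `|cim w|)//.
by move: (expR _) => X; field.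
Qed.

End bessel_moments.

(** * Complex integrals and densities *)

Section complex_integral.
Context d (T : measurableType d) (R : realType).
Variable mu : {measure set T -> \bar R}.
Implicit Types (F : T -> R[i]) (g : T -> R).

(** Componentwise, in the same form as [T1_defined] and [T1], which are instances of [cintegrable]
    and [cint] by conversion. *)
Definition cintegrable F :=
  mu.-integrable [set: T] (EFin \o (fun x => cre (F x))) /\
  mu.-integrable [set: T] (EFin \o (fun x => cim (F x))).

Definition cint F : R[i] :=
  Complex (Rintegral mu [set: T] (fun x => cre (F x)))
          (Rintegral mu [set: T] (fun x => cim (F x))).

Definition cmeasurable F :=
  measurable_fun [set: T] (fun x => cre (F x)) /\
  measurable_fun [set: T] (fun x => cim (F x)).

Lemma cmeasurableD F1 F2 : cmeasurable F1 -> cmeasurable F2 ->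
  cmeasurable (fun x => F1 x + F2 x).
Proof.
move=> [r1 i1] [r2 i2]; split.
  by under eq_fun do rewrite creD; exact: measurable_funD.
by under eq_fun do rewrite cimD; exact: measurable_funD.
Qed.

Lemma cmeasurableM F1 F2 : cmeasurable F1 -> cmeasurable F2 ->
  cmeasurable (fun x => F1 x * F2 x).
Proof.
move=> [r1 i1] [r2 i2]; split.
  by under eq_fun do rewrite creM; apply: measurable_funB; exact: measurable_funM.
by under eq_fun do rewrite cimM; apply: measurable_funD; exact: measurable_funM.
Qed.

Lemma cmeasurable_cst (z : R[i]) : cmeasurable (cst z).
Proof. by split; exact: measurable_cst. Qed.

Lemma cmeasurable_real g : measurable_fun [set: T] g ->
  cmeasurable (fun x => (g x)%:C%C).
Proof. by move=> mg; split => //=; exact: measurable_cst. Qed.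

Lemma cmeasurableX F n : cmeasurable F -> cmeasurable (fun x => F x ^+ n).
Proof.
move=> mF; elim: n => [|n ih].
  by under eq_fun do rewrite expr0; exact: cmeasurable_cst.
by under eq_fun do rewrite exprS; exact: cmeasurableM.
Qed.

Lemma cmeasurable_sum (t : nat -> T -> R[i]) n : (forall i, cmeasurable (t i)) ->
  cmeasurable (fun x => \sum_(i < n) t i x).
Proof.
move=> mt; elim: n => [|n ih].
  by under eq_fun do rewrite big_ord0; exact: cmeasurable_cst.
by under eq_fun do rewrite big_ord_recr/=; exact: cmeasurableD.
Qed.

Lemma cmeasurable_ccvg (u : nat -> T -> R[i]) F : (forall n, cmeasurable (u n)) ->
  (forall x, ccvg (u^~ x) (F x)) -> cmeasurable F.
Proof.
move=> mu_ uF; split.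
  apply: (@measurable_fun_cvg _ _ _ _ (fun n x => cre (u n x))) => [n|x _].
    by have [] := mu_ n.
  exact: ccvg_cre.
apply: (@measurable_fun_cvg _ _ _ _ (fun n x => cim (u n x))) => [n|x _].
  by have [] := mu_ n.
exact: ccvg_cim.
Qed.

Lemma cmeasurable_cmod F : cmeasurable F -> measurable_fun [set: T] (fun x => cmod (F x)).
Proof.
move=> [mr mi].
have ms : measurable_fun [set: R] (@Num.sqrt R).
  exact: continuous_measurable_fun (@sqrt_continuous R).
have m2 : measurable_fun [set: T] (fun x => cre (F x) ^+ 2 + cim (F x) ^+ 2).
  by apply: measurable_funD; exact: measurable_funX.
rewrite (_ : (fun x => cmod (F x)) =
    Num.sqrt \o (fun x => cre (F x) ^+ 2 + cim (F x) ^+ 2)).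
  exact: measurableT_comp ms m2.
by apply/funext => x; rewrite /= cmodE.
Qed.

Lemma cintegrable_le F g : cmeasurable F ->
  mu.-integrable [set: T] (EFin \o g) -> (forall x, cmod (F x) <= g x) ->
  cintegrable F.
Proof.
move=> [mr mi] ig Fg; split; apply: (integrable_le_ge0 _ _ ig) => // x _.
  exact: le_trans (norm_cre _) (Fg x).
exact: le_trans (norm_cim _) (Fg x).
Qed.

Lemma cintB F1 F2 : cintegrable F1 -> cintegrable F2 ->
  cint (fun x => F1 x - F2 x) = cint F1 - cint F2.
Proof.
move=> [r1 i1] [r2 i2]; apply: complex_ext; rewrite /cint/=.
  by rewrite -RintegralB//; congr Rintegral; apply/funext => x;
     rewrite creD creN.
by rewrite -RintegralB//; congr Rintegral; apply/funext => x;
   rewrite cimD cimN.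
Qed.

Lemma cintZ (z : R[i]) F : cintegrable F -> cint (fun x => z * F x) = z * cint F.
Proof.
move=> [r1 i1]; apply: complex_ext; rewrite /cint/=.
  rewrite creM/= -!RintegralZl// -RintegralB//.
  - by congr Rintegral; apply/funext => x; rewrite creM.
  - exact: integrableZl_EFin.
  - exact: integrableZl_EFin.
rewrite cimM/= -!RintegralZl// -RintegralD//.
- by congr Rintegral; apply/funext => x; rewrite cimM.
- exact: integrableZl_EFin.
- exact: integrableZl_EFin.
Qed.

Lemma cmod_cint_le F g : cmeasurable F ->
  mu.-integrable [set: T] (EFin \o g) -> (forall x, cmod (F x) <= g x) ->
  cmod (cint F) <= Rintegral mu [set: T] g.
Proof.
move=> mF ig Fg; have [ir ii] := cintegrable_le mF ig Fg.
apply: cmod_le_dual => c s cs; rewrite /cint/= -!RintegralZl// -RintegralD//.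
- apply: le_Rintegral => //.
    by apply: integrableD_EFin => //; exact: integrableZl_EFin.
  by move=> x _; apply: le_trans (Fg x); exact: dual_le_cmod.
- exact: integrableZl_EFin.
- exact: integrableZl_EFin.
Qed.

End complex_integral.

Section density.
Context {R : realType}.
Local Notation mu := (@lebesgue_measure R).

Lemma ge0_integralT_opp (h : R -> \bar R) : measurable_fun [set: R] h ->
  (forall x, 0 <= h x)%E ->
  (\int[mu]_x h (- x)%R = \int[mu]_x h x)%E.
Proof.
move=> mh h0.
transitivity (\int[pushforward mu (-%R : _ -> measurableTypeR R)]_x h x)%E.
  by rewrite ge0_integral_pushforward.
by apply: eq_measure_integral => A mA _; exact: lebesgue_measureN.
Qed.

Lemma le_integralT_even (h : R -> \bar R) : measurable_fun [set: R] h ->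
  (forall x, 0 <= h x)%E -> (forall x, h (- x)%R = h x) ->
  (\int[mu]_x h x <= 2%:E * \int[mu]_(x in `]0%R, +oo[) h x)%E.
Proof.
move=> mh h0 heven.
have mhS D : measurable_fun D h by exact: measurable_funTS.
have -> : [set: R] = `]-oo, 0%R[ `|` `[0%R, +oo[.
  apply/seteqP; split => // x _ /=; rewrite !in_itv/= andbT.
  by case: (ltP x 0) => ?; [left|right].
rewrite ge0_integral_setU//=; last first.
  apply/disj_setPS => x /=; rewrite !in_itv/= andbT => -[x0 x0'].
  by move: (lt_le_trans x0 x0'); rewrite ltxx.
  exact: mhS.
rewrite integral_itv_obnd_cbnd// mule_natl mule2n leeD2r//.
rewrite ge0_integration_by_substitution0//.
under [leRHS]eq_integral do rewrite heven.
apply: ge0_subset_integral => //; first exact: mhS.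
by move=> x /=; rewrite !in_itv/=; exact: ltW.
Qed.

Variables (g : R -> R) (mg : measurable_fun [set: R] g) (g0 : forall x, 0 <= g x).
Local Notation nu := (density_measure mg g0).

Import HBNNSimple.

(** On a level set of h the measure is by definition the integral of g, so both sides are the same
    finite sum over the values of h. A negative value has an empty level set. *)
Lemma integral_density_nnsfun (h : {nnsfun R >-> R}) :
  (\int[nu]_x (h x)%:E = \int[mu]_x ((h x)%:E * (g x)%:E))%E.
Proof.
have mgE : measurable_fun [set: R] (EFin \o g) by exact/measurable_EFinP.
have mhy y : measurable (h @^-1` [set y] : set R).
  by rewrite -[X in measurable X]setTI; exact: measurable_funP.
have mi y : measurable_fun [set: R] (\1_(h @^-1` [set y]) : R -> R).
  exact: measurable_indic (mhy y).
rewrite integralT_nnsfun sintegralE.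
under [RHS]eq_integral => x _.
  rewrite fimfunE -fsumEFin// ge0_mule_fsuml; last first.
    by move=> y; exact: nnfun_muleindic_ge0.
  over.
rewrite ge0_integral_fsum//; last 2 first.
- move=> y; apply: emeasurable_funM => //; apply/measurable_EFinP.
  apply: measurable_funM; first exact: measurable_cst.
  exact: mi.
- move=> y x _; apply: mule_ge0; last by rewrite lee_fin.
  exact: nnfun_muleindic_ge0.
apply: eq_fsbigr => y _.
have [y0|y0] := leP 0 y.
  under [RHS]eq_integral do rewrite EFinM -muleA.
  rewrite ge0_integralZl_EFin//; last 2 first.
  - by move=> x _; rewrite mule_ge0 ?lee_fin.
  - apply: emeasurable_funM; last exact: mgE.
    by apply/measurable_EFinP; exact: (mi y).
  congr (_ * _)%E.
  rewrite -[LHS]/(\int[mu]_(x in h @^-1` [set y]) (g x)%:E)%E [LHS]integral_mkcond.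
  by apply: eq_integral => x _; rewrite epatch_indic/= muleC.
rewrite preimage_nnfun0// measure0 mule0 integral0_eq// => x _.
by rewrite indic0 mulr0 mul0e.
Qed.

Lemma ge0_integral_density (f : R -> \bar R) : measurable_fun [set: R] f ->
  (forall x, 0 <= f x)%E ->
  (\int[nu]_x f x = \int[mu]_x (f x * (g x)%:E))%E.
Proof.
move=> mf f0; have mgE : measurable_fun [set: R] (EFin \o g) by exact/measurable_EFinP.
pose f_ := nnsfun_approx measurableT mf.
have mf_ n : measurable_fun [set: R] (EFin \o f_ n) by exact/measurable_EFinP.
have nd_f_ x a b : (a <= b)%N -> f_ a x <= f_ b x.
  by move=> ab; exact/lefP/nd_nnsfun_approx.
have fE x : f x = lim ((f_ n x)%:E @[n --> \oo]).
  by apply/esym/cvg_lim => //; exact: cvg_nnsfun_approx.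
have fgE x : (f x * (g x)%:E)%E = lim (((f_ n x)%:E * (g x)%:E)%E @[n --> \oo]).
  apply/esym/cvg_lim => //; apply: cvgeZr => //; exact: cvg_nnsfun_approx.
transitivity (lim (\int[nu]_x (f_ n x)%:E @[n --> \oo])%E).
  rewrite -monotone_convergence//=.
  - by apply: eq_integral => x _; rewrite fE.
  - by move=> n x _; rewrite lee_fin.
  - by move=> x _ a b ab; rewrite lee_fin nd_f_.
transitivity (lim (\int[mu]_x ((f_ n x)%:E * (g x)%:E) @[n --> \oo])%E).
  by apply: congr_lim; apply/funext => n /=; exact: integral_density_nnsfun.
rewrite -monotone_convergence//=.
- by apply: eq_integral => x _; rewrite fgE.
- move=> n; apply: emeasurable_funM; last exact: mgE.
  exact: mf_.
- by move=> n x _; rewrite mule_ge0 ?lee_fin.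
- by move=> x _ a b ab; apply: lee_wpmul2r; rewrite ?lee_fin ?nd_f_.
Qed.

End density.

(** * Weighted estimates *)

Section gaussian_weights.
Context {R : realType}.
Implicit Types (r b s c g : R).

(** The exponential is split into two halves, each of which absorbs one factor. *)
Lemma gauss_powR_bound c g : 0 < c -> 0 <= g -> exists2 C, 0 < C &
  forall s, 0 <= s -> (1 + s `^ g) * (1 + s) * expR (- (c * s)) <= C.
Proof.
move=> c0 g0; have c20 : 0 < c / 2 by rewrite divr_gt0.
have [C1 C10 h1] := powR_le_expR g0 c20.
have [C2 C20 h2] := powR_le_expR ler01 c20.
exists ((1 + C1) * (1 + C2)) => [|s s0]; first by rewrite mulr_gt0 ?addr_gt0.
have e1 : 1 <= expR (c / 2 * s) by rewrite -[leLHS]expR0 ler_expR mulr_ge0// ltW.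
rewrite expRN ler_pdivrMr ?expR_gt0//.
have -> : expR (c * s) = expR (c / 2 * s) * expR (c / 2 * s).
  by rewrite -expRD; congr expR; field.
rewrite mulrACA; apply: ler_pM.
- by rewrite addr_ge0// powR_ge0.
- by rewrite addr_ge0.
- have := h1 s s0; rewrite mulrDl mul1r; lra.
- have := h2 s s0; rewrite powRr1// mulrDl mul1r; lra.
Qed.

(** Either r <= 2 |r - b|, and the second factor suffices, or r <= 2 b, so that r^2 <= 2 b r = (2/m)
    (m b r) and the first one does. *)
Lemma powR_le_split (m g : R) : 0 < m -> 0 <= g -> exists2 C, 0 < C &
  forall r b, 0 <= r -> 0 <= b ->
  r `^ (2 * g) <= C * ((1 + (m * b * r) `^ g) * (1 + ((r - b) ^+ 2) `^ g)).
Proof.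
move=> m0 g0; exists (4 `^ g + (2 / m) `^ g) => [|r b r0 b0].
  by rewrite ltr_pwDl ?powR_ge0// powR_gt0.
have X0 : 0 <= (m * b * r) `^ g by exact: powR_ge0.
have Y0 : 0 <= ((r - b) ^+ 2) `^ g by exact: powR_ge0.
have P0 : 0 <= 4 `^ g :> R by exact: powR_ge0.
have Q0 : 0 <= (2 / m) `^ g by exact: powR_ge0.
have XY0 := mulr_ge0 X0 Y0.
rewrite powRrM powR_mulrn//.
have [h|h] := leP (r ^+ 2) (4 * (r - b) ^+ 2).
  have : (r ^+ 2) `^ g <= 4 `^ g * ((r - b) ^+ 2) `^ g.
    rewrite -powRM ?sqr_ge0//; apply: ge0_ler_powR => //.
    + by rewrite nnegrE sqr_ge0.
    + by rewrite nnegrE mulr_ge0 ?sqr_ge0.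
  nra.
have rb : r <= 2 * b.
  rewrite leNgt; apply/negP => br; move: h; apply/negP; rewrite -leNgt.
  have : 0 <= (r - 2 * b) * (3 * r - 2 * b) by rewrite mulr_ge0//; lra.
  nra.
have : (r ^+ 2) `^ g <= (2 / m) `^ g * (m * b * r) `^ g.
  rewrite -powRM ?divr_ge0 ?mulr_ge0 ?(ltW m0)//; apply: ge0_ler_powR => //.
  + by rewrite nnegrE sqr_ge0.
  + by rewrite nnegrE !mulr_ge0 ?invr_ge0 ?(ltW m0).
  + rewrite (_ : 2 / m * _ = 2 * b * r); last by field; rewrite gt_eqF.
    by rewrite expr2 ler_wpM2r.
nra.
Qed.

(* The factor 1 + (m b r)^g is the decay of the Bessel function; it
   compensates the growth of the weight r^(2 g) near r = b. *)
Lemma shifted_gauss_weight c m g : 0 < c -> 0 < m -> 0 <= g ->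
  exists2 C, 0 < C & forall r b, 0 <= r -> 0 <= b ->
  expR (- (c * (r - b) ^+ 2)) / (1 + (m * b * r) `^ g) * r `^ (2 * g) <=
  C / (1 + (r - b) ^+ 2).
Proof.
move=> c0 m0 g0.
have [C1 C10 h1] := gauss_powR_bound c0 g0.
have [C2 C20 h2] := powR_le_split m0 g0.
exists (C2 * C1) => [|r b r0 b0]; first by rewrite mulr_gt0.
have d0 : 0 < 1 + (m * b * r) `^ g by rewrite ltr_pwDl// powR_ge0.
have e0 : 0 < 1 + (r - b) ^+ 2 by rewrite ltr_pwDl// sqr_ge0.
rewrite ler_pdivlMr// mulrAC -mulrA mulrAC ler_pdivrMr//.
have := h1 _ (sqr_ge0 (r - b)); have := h2 r b r0 b0.
have := expR_gt0 (- (c * (r - b) ^+ 2)).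
set D := 1 + (m * b * r) `^ g in d0 *; set s := (r - b) ^+ 2 in e0 *.
move: (expR _) (r `^ _) (s `^ g) => E P Q E0 hP hC.
have hP' := ler_wpM2l (mulr_ge0 (ltW E0) (ltW e0)) hP.
have hC' := ler_wpM2l (mulr_ge0 (ltW C20) (ltW d0)) hC.
rewrite mulrA (le_trans hP')//.
have -> : E * (1 + s) * (C2 * (D * (1 + Q))) = C2 * D * ((1 + Q) * (1 + s) * E) by ring.
by rewrite (le_trans hC')// mulrAC.
Qed.

(** Half of the Gaussian absorbs the linear term, by A r <= (c/2) r^2 + A^2 / (2 c). The two bounds
    share one constant because [Lp_weight_bound] asks for a weight that is both bounded and
    decaying. *)
Lemma gauss_exp_weight c (A g : R) : 0 < c -> 0 <= g ->
  exists2 C, 0 < C & forall r, 0 <= r ->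
  expR (- (c * r ^+ 2) + A * r) <= C /\
  expR (- (c * r ^+ 2) + A * r) * r `^ (2 * g) <= C / (1 + r ^+ 2).
Proof.
move=> c0 g0; have c20 : 0 < c / 2 by rewrite divr_gt0.
have [C1 C10 h1] := gauss_powR_bound c20 g0.
pose E := expR (A ^+ 2 / (2 * c)); have E0 : 0 < E by exact: expR_gt0.
exists (E * C1) => [|r r0]; first by rewrite mulr_gt0.
have eE : expR (- (c * r ^+ 2) + A * r) <= E * expR (- (c / 2 * r ^+ 2)).
  rewrite -expRD ler_expR -subr_ge0.
  rewrite (_ : _ - _ = (c * r - A) ^+ 2 / (2 * c)); last by field; rewrite gt_eqF.
  by rewrite divr_ge0 ?sqr_ge0// mulr_ge0// ltW.
have := h1 _ (sqr_ge0 r).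
have P0 : 0 <= (r ^+ 2) `^ g by exact: powR_ge0.
have s0 : 0 <= r ^+ 2 by exact: sqr_ge0.
have e0 : 0 < expR (- (c / 2 * r ^+ 2)) by exact: expR_gt0.
rewrite [r `^ (2 * g)]powRrM powR_mulrn//.
move: eE; move: (expR (- (c * _) + _)) (expR (- _)) e0 => X Y Y0 XY h.
have Ps0 := mulr_ge0 P0 s0.
have hY : Y <= C1.
  apply: le_trans h; rewrite ler_peMl ?(ltW Y0)//; nra.
have hPY : (r ^+ 2) `^ g * (1 + r ^+ 2) * Y <= C1.
  apply: le_trans h; rewrite ler_wpM2r ?(ltW Y0)// ler_wpM2r//; first lra.
  by rewrite lerDr.
split.
  by rewrite (le_trans XY)// ler_pM2l.
rewrite ler_pdivlMr; last by rewrite ltr_pwDl.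
rewrite -mulrA (le_trans (ler_wpM2r _ XY))//.
  by rewrite mulr_ge0// addr_ge0.
by rewrite -mulrA ler_pM2l// mulrC.
Qed.

End gaussian_weights.

Section weighted_integrals.
Context {R : realType}.
Local Notation mu := (@lebesgue_measure R).
Variables (n : nat) (k : R).
Hypotheses (n1 : (1 <= n)%N) (hk : (n%:R - 1) / (2 * n%:R) <= k).
Local Notation gam := (alpha k n + 2^-1).
Implicit Types (x u b K : R) (H Phi : R -> R).

Definition rootabs x : R := `|x| `^ (n%:R)^-1.

Let n0 : 0 < n%:R :> R. Proof. by rewrite ltr0n. Qed.

(** The hypothesis on k is exactly this lower bound; it gives g >= 0 and places the moments in
    [0, 1]. *)
Lemma alpha_geN2V : - 2^-1 <= alpha k n.
Proof.
move: hk; rewrite /alpha ler_pdivrMr ?mulr_gt0// => h; lra.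
Qed.

Let g0 : 0 <= gam. Proof. by have := alpha_geN2V; lra. Qed.

Lemma rootabs_ge0 x : 0 <= rootabs x. Proof. exact: powR_ge0. Qed.

Lemma rootabsN x : rootabs (- x) = rootabs x. Proof. by rewrite /rootabs normrN. Qed.

Lemma sqr_rootabs x : `|x| `^ (2 / n%:R) = rootabs x ^+ 2.
Proof. by rewrite mulrC powRrM powR_mulrn ?powR_ge0. Qed.

Lemma measurable_rootabs : measurable_fun [set: R] rootabs.
Proof.
apply: (measurableT_comp (measurable_powR _)); exact: normr_measurable.
Qed.

Definition mukn_const : R :=
  `| (2 * Gamma (alpha k n + 1))^-1 * (n%:R / 2) `^ (alpha k n) |.

Lemma mukn_const_ge0 : 0 <= mukn_const. Proof. exact: normr_ge0. Qed.

(** Separates the Jacobian of r = u^(1/n), which is u^(1/n - 1) up to the factor 1/n, from the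
    weight r^(2 g). *)
Lemma mukn_densityE u : 0 < u ->
  mukn_density k n u = mukn_const * (rootabs u `^ (2 * gam) * u `^ (n%:R^-1 - 1)).
Proof.
move=> u0; rewrite /mukn_density -/mukn_const gtr0_norm//; congr (_ * _).
rewrite /rootabs gtr0_norm// -powRrM -powRD; last by rewrite (gt_eqF u0) implybT.
by congr powR; rewrite /alpha; field; rewrite gt_eqF.
Qed.

Lemma mukn_densityN u : mukn_density k n (- u) = mukn_density k n u.
Proof. by rewrite /mukn_density normrN. Qed.

(** The pull-back of n dr / (1 + (r - b)^2), with primitive n atan(u^(1/n) - b). The increments of
    atan are below pi, which makes the integral bounded uniformly in b. *)
Definition atan_profile b u : R :=
  u `^ (n%:R^-1 - 1) / (1 + (u `^ n%:R^-1 - b) ^+ 2).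

Lemma continuous_atan_profile b u : 0 < u -> {for u, continuous (atan_profile b)}.
Proof.
move=> u0; apply: cvgM; first exact: continuous_powR_pos.
apply: cvgV; first by rewrite gt_eqF// ltr_pwDl// sqr_ge0.
apply: cvgD; first exact: cvg_cst.
apply: (@continuous_comp _ _ _ (fun u : R => u `^ n%:R^-1 - b) (fun y : R => y ^+ 2)).
  by apply: cvgB; [exact: continuous_powR_pos|exact: cvg_cst].
exact: exprn_continuous.
Qed.

Lemma le_integral_atan_profile b :
  (\int[mu]_(u in `]0%R, +oo[) (atan_profile b u)%:E <= (n%:R * pi)%:E)%E.
Proof.
apply: (@le_integral0y_is_derive _ _ (fun u => n%:R * atan (u `^ n%:R^-1 - b))).
- by move=> u u0; rewrite divr_ge0 ?powR_ge0// addr_ge0// sqr_ge0.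
- by move=> u; exact: continuous_atan_profile.
- move=> u u0.
  have d1 : is_derive u 1 (fun u => u `^ n%:R^-1 - b) (n%:R^-1 * u `^ (n%:R^-1 - 1)).
    rewrite -[X in is_derive _ _ _ X]subr0.
    exact: is_deriveB (is_derive1_powR _ u0) (is_derive_cst _ _ _).
  have d2 := @is_derive1_comp R atan (fun u => u `^ n%:R^-1 - b) u _ _
    (is_derive1_atan _) d1.
  have d3 := is_deriveZ n%:R d2.
  apply: (is_derive_eq d3); rewrite /GRing.scale/= /atan_profile.
  field; rewrite (gt_eqF n0)/= gt_eqF//.
  by rewrite ltr_pwDl// sqr_ge0.
- move=> a c _ _; rewrite -mulrBr ler_pM2l//.
  have := atan_ltpi2 (c `^ n%:R^-1 - b); have := atan_gtNpi2 (a `^ n%:R^-1 - b).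
  have : pi / 2 + pi / 2 = pi :> R by field.
  lra.
Qed.

Let W : R := 2 * (mukn_const * (n%:R * pi)).

(** By evenness the integral is at most twice the one over the half-line, where the assumption in r
    becomes a pointwise comparison with [atan_profile]. The bound is therefore free of b. *)
Lemma integral_weight_le H K b : measurable_fun [set: R] H -> 0 <= K ->
  (forall r, 0 <= r -> 0 <= H r) ->
  (forall r, 0 <= r -> H r * r `^ (2 * gam) <= K / (1 + (r - b) ^+ 2)) ->
  (\int[mukn k n]_x (H (rootabs x))%:E <= (K * W)%:E)%E.
Proof.
move=> mH K0 H0 HK.
have mHr : measurable_fun [set: R] (fun x => H (rootabs x)).
  exact: measurableT_comp mH measurable_rootabs.
have md := @mukn_density_measurable R k n.
have mHd : measurable_fun [set: R] (fun x => H (rootabs x) * mukn_density k n x).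
  exact: measurable_funM.
have Hd0 x : 0 <= H (rootabs x) * mukn_density k n x.
  by rewrite mulr_ge0 ?H0 ?rootabs_ge0 ?mukn_density_ge0.
rewrite /mukn ge0_integral_density//; last 2 first.
- exact/measurable_EFinP.
- by move=> x; rewrite lee_fin H0// rootabs_ge0.
under eq_integral do rewrite -EFinM.
apply: le_trans (le_integralT_even _ _ _) _.
- exact/measurable_EFinP.
- by move=> x; rewrite lee_fin.
- by move=> x; rewrite rootabsN mukn_densityN.
have -> : (K * W)%:E = (2%:E * ((mukn_const * K)%:E * (n%:R * pi)%:E))%E.
  by rewrite -!EFinM /W; congr EFin; ring.
apply: lee_wpmul2l => //.
have cK0 : 0 <= mukn_const * K by rewrite mulr_ge0// mukn_const_ge0.
have ma : measurable_fun (`]0%R, +oo[ : set R) (atan_profile b).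
  by apply: continuous_pos_measurable => u; exact: continuous_atan_profile.
apply: (@le_trans _ _ (\int[mu]_(x in `]0%R, +oo[)
   ((mukn_const * K)%:E * (atan_profile b x)%:E))%E).
  apply: ge0_le_integral => //.
  - by move=> x _; rewrite lee_fin.
  - exact/measurable_EFinP/measurable_funTS.
  - by apply/measurable_EFinP; apply: measurable_funM.
  move=> u /=; rewrite in_itv/= andbT => u0.
  rewrite lee_fin mukn_densityE// mulrCA -mulrA ler_wpM2l ?mukn_const_ge0//.
  rewrite /atan_profile mulrA mulrCA mulrC ler_wpM2l ?powR_ge0//.
  by rewrite -[u in u `^ _ - b](gtr0_norm u0) HK// rootabs_ge0.
rewrite ge0_integralZl_EFin//; last 2 first.
- by move=> x _; rewrite lee_fin divr_ge0 ?powR_ge0// addr_ge0// sqr_ge0.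
- exact/measurable_EFinP.
by apply: lee_wpmul2l; rewrite ?lee_fin//; exact: le_integral_atan_profile.
Qed.

End weighted_integrals.

Section Lp_against_weights.
Context {R : realType}.
Variables (n : nat) (k : R).
Hypotheses (n1 : (1 <= n)%N) (hk : (n%:R - 1) / (2 * n%:R) <= k).
Local Notation gam := (alpha k n + 2^-1).
Local Notation muk := (mukn k n).
Implicit Types (H Phi : R -> R) (K b : R).

(* Since Phi <= 1 + Phi^p, pairing with a bounded integrable weight needs no
   Hoelder inequality. *)
Lemma Lp_weight_bound (p : \bar R) Phi : measurable_fun [set: R] Phi ->
  (forall x, 0 <= Phi x) -> (1 <= p)%E ->
  (Lnorm muk p (fun x => (Phi x)%:E) < +oo)%E ->
  exists A, forall H K b, measurable_fun [set: R] H ->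
    (forall r, 0 <= r -> 0 <= H r <= K) ->
    (forall r, 0 <= r -> H r * r `^ (2 * gam) <= K / (1 + (r - b) ^+ 2)) ->
    (\int[muk]_x (Phi x * H (rootabs n x))%:E <= (K * A)%:E)%E.
Proof.
move=> mPhi Phi0 p1 hp.
pose W : R := 2 * (mukn_const n k * (n%:R * pi)).
have hH H K b : measurable_fun [set: R] H ->
    (forall r, 0 <= r -> 0 <= H r <= K) ->
    (forall r, 0 <= r -> H r * r `^ (2 * gam) <= K / (1 + (r - b) ^+ 2)) ->
    [/\ 0 <= K, measurable_fun [set: R] (fun x => H (rootabs n x)),
        (forall x, 0 <= H (rootabs n x) <= K) &
        (\int[muk]_x (H (rootabs n x))%:E <= (K * W)%:E)%E].
  move=> mH HK Hw; have /andP[h0 hK] := HK 0 (lexx _).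
  have K0 : 0 <= K by exact: le_trans hK.
  split => //.
  - exact: measurableT_comp mH (measurable_rootabs n).
  - by move=> x; exact: HK (rootabs_ge0 n x).
  - apply: (@integral_weight_le _ n k n1 H K b) => //.
    by move=> r /HK /andP[].
case: p p1 hp => [r|_|//].
- rewrite lee_fin => r1 hp.
  have r0 : r^-1 != 0 by rewrite invr_neq0// gt_eqF// (lt_le_trans ltr01).
  have Ip : (\int[muk]_x (Phi x `^ r)%:E < +oo)%E.
    move: hp; rewrite unlock => /(lty_poweRy r0).
    by under eq_integral => x _ do rewrite /= ger0_norm//.
  have mP : measurable_fun [set: R] (fun x => Phi x `^ r).
    exact: measurableT_comp (measurable_powR r) mPhi.
  have I0 : (0 <= \int[muk]_x (Phi x `^ r)%:E)%E.
    by apply: integral_ge0 => x _; rewrite lee_fin powR_ge0.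
  exists (W + fine (\int[muk]_x (Phi x `^ r)%:E)%E) => H K b mH HK Hw.
  have [K0 mHr HrK IH] := hH H K b mH HK Hw.
  apply: (@le_trans _ _ (\int[muk]_x ((H (rootabs n x))%:E + K%:E * (Phi x `^ r)%:E))%E).
    apply: ge0_le_integral => //.
    - by move=> x _; rewrite lee_fin mulr_ge0//; have /andP[] := HrK x.
    - by apply/measurable_EFinP; exact: measurable_funM.
    - apply: emeasurable_funD; first exact/measurable_EFinP.
      by apply/measurable_EFinP; exact: measurable_funM.
    move=> x _; rewrite -EFinM -EFinD lee_fin.
    have /andP[h0 h1] := HrK x.
    have Px : Phi x <= 1 + Phi x `^ r.
      have [P1|P1] := leP (Phi x) 1.
        by rewrite (le_trans P1)// lerDl powR_ge0.
      by rewrite (le_trans (le1r_powR (ltW P1) r1))// lerDr.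
    have P0 : 0 <= Phi x `^ r by exact: powR_ge0.
    have := ler_wpM2r h0 Px; have := ler_wpM2l P0 h1; nra.
  rewrite ge0_integralD//; last 4 first.
  - by move=> x _; rewrite lee_fin; have /andP[] := HrK x.
  - exact/measurable_EFinP.
  - by move=> x _; rewrite -EFinM lee_fin mulr_ge0// powR_ge0.
  - by apply/measurable_EFinP; exact: measurable_funM.
  rewrite ge0_integralZl_EFin//; last 2 first.
  - by move=> x _; rewrite lee_fin powR_ge0.
  - exact/measurable_EFinP.
  rewrite mulrDr EFinD EFinM [X in (_ <= _ + X)%E]EFinM fineK ?ge0_fin_numE//.
  by rewrite leeD2r// -EFinM.
(* For p = +oo the norm is an essential supremum when the space has positive measure; in the
   remaining null case every integral vanishes. *)
rewrite unlock; case: ifPn => [mu0 hs|mu0 _].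
  pose M := Num.max (fine (ess_sup muk (abse \o (fun x => (Phi x)%:E)))) 0.
  have M0 : 0 <= M by rewrite le_max lexx orbT.
  have PM : {ae muk, forall x, Phi x <= M}.
    have := ess_sup_ge muk (abse \o (fun x => (Phi x)%:E)).
    apply: filterS => x /=; rewrite ger0_norm//; move: hs; rewrite /M.
    case: (ess_sup _ _) => [s||]//= _; rewrite lee_fin => h.
    by rewrite le_max h.
  exists (M * W) => H K b mH HK Hw.
  have [K0 mHr HrK IH] := hH H K b mH HK Hw.
  apply: (@le_trans _ _ (\int[muk]_x (M%:E * (H (rootabs n x))%:E))%E).
    apply: ae_ge0_le_integral => //.
    - by move=> x _; rewrite lee_fin mulr_ge0//; have /andP[] := HrK x.
    - by apply/measurable_EFinP; exact: measurable_funM.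
    - by move=> x _; rewrite -EFinM lee_fin mulr_ge0//; have /andP[] := HrK x.
    - by apply/measurable_EFinP; exact: measurable_funM.
    apply: filterS PM => x PM _; rewrite -EFinM lee_fin ler_wpM2r//.
    by have /andP[] := HrK x.
  rewrite ge0_integralZl_EFin//; last 2 first.
  - by move=> x _; rewrite lee_fin; have /andP[] := HrK x.
  - exact/measurable_EFinP.
  by rewrite mulrCA EFinM lee_wpmul2l ?lee_fin.
exists 0 => H K b mH HK Hw.
have [K0 mHr HrK IH] := hH H K b mH HK Hw.
rewrite mulr0 null_set_integral//.
- by apply/measurable_EFinP; exact: measurable_funM.
- by apply/eqP; rewrite eq_le measure_ge0 andbT leNgt.
Qed.

Lemma ge0_integral_mukn_opp (h : R -> \bar R) : measurable_fun [set: R] h ->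
  (forall x, 0 <= h x)%E ->
  (\int[muk]_x h (- x)%R = \int[muk]_x h x)%E.
Proof.
move=> mh h0.
have mhN : measurable_fun [set: R] (fun x : R => h (- x)).
  exact: measurableT_comp mh (@oppr_measurable R _).
rewrite /mukn !ge0_integral_density//.
rewrite -[RHS]ge0_integralT_opp.
- by apply: eq_integral => x _; rewrite mukn_densityN.
- apply: emeasurable_funM => //; apply/measurable_EFinP.
  exact: mukn_density_measurable.
- by move=> x; rewrite mule_ge0// lee_fin mukn_density_ge0.
Qed.

End Lp_against_weights.

(** * The transform *)

Section bessel_transform.
Context {R : realType}.
Variables (n : nat) (k : R) (p : \bar R) (a : R) (f : R -> R[i]).
Hypotheses (n1 : (1 <= n)%N) (hk : (n%:R - 1) / (2 * n%:R) <= k).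
Hypotheses (p1 : (1 <= p)%E) (a0 : 0 < a).
Hypotheses (mre : measurable_fun [set: R] (@cre R \o f))
           (mim : measurable_fun [set: R] (@cim R \o f)).
Hypothesis fp : (Lnorm (mukn k n) p
     (fun x => (expR (n%:R * a * `|x| `^ (2 / n%:R)) * cmod (f x))%:E) < +oo)%E.
Local Notation gam := (alpha k n + 2^-1).
Local Notation muk := (mukn k n).
Local Notation Mk := (bessel_moment (alpha k n)).
Local Notation rd := (rootabs n).
Implicit Types (z h : R[i]) (x : R).

Let n0 : 0 < n%:R :> R. Proof. by rewrite ltr0n. Qed.
Let na0 : 0 < n%:R * a. Proof. exact: mulr_gt0. Qed.
Let al : - 2^-1 <= alpha k n. Proof. exact: alpha_geN2V. Qed.
Let g0 : 0 <= gam. Proof. by have := al; lra. Qed.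
Let uM : unit_seq Mk. Proof. exact: unit_seq_bessel_moment. Qed.

Let Phi x := expR (n%:R * a * rd x ^+ 2) * cmod (f x).
(** The even part of f involves f at x and at -x. Since the weight is even, Psi carries both values,
    and [even_majorant] is |f(x)| + |f(-x)|. *)
Let Psi x := Phi x + Phi (- x).
Definition even_majorant x := Psi x * expR (- (n%:R * a * rd x ^+ 2)).
Local Notation G := even_majorant.

Let cmf : cmeasurable f. Proof. by []. Qed.

Let mopp : measurable_fun [set: R] (-%R : R -> R).
Proof. exact: oppr_measurable. Qed.

Let mrd : measurable_fun [set: R] rd. Proof. exact: measurable_rootabs. Qed.

Let Phi_ge0 x : 0 <= Phi x.
Proof. by rewrite mulr_ge0 ?expR_ge0 ?cmod_ge0. Qed.

Let mPhi : measurable_fun [set: R] Phi.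
Proof.
apply: measurable_funM; last exact: cmeasurable_cmod.
apply: measurableT_comp => //; apply: measurable_funM => //.
exact: measurable_funX.
Qed.

Let mPhiN : measurable_fun [set: R] (fun x => Phi (- x)).
Proof. exact: measurableT_comp mPhi mopp. Qed.

Let Psi_weight : exists A, forall (H : R -> R) K b, measurable_fun [set: R] H ->
    (forall r, 0 <= r -> 0 <= H r <= K) ->
    (forall r, 0 <= r -> H r * r `^ (2 * gam) <= K / (1 + (r - b) ^+ 2)) ->
  measurable_fun [set: R] (fun x => Psi x * H (rd x)) /\
  (\int[muk]_x (Psi x * H (rd x))%:E <= (K * A)%:E)%E.
Proof.
have fp' : (Lnorm muk p (fun x => (Phi x)%:E) < +oo)%E.
  by move: fp; congr (_ < _)%E; apply: eq_Lnorm => x; rewrite /Phi sqr_rootabs.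
have [A hA] := Lp_weight_bound n1 mPhi Phi_ge0 p1 fp'.
exists (A + A) => H K b mH HK Hw.
have mHr : measurable_fun [set: R] (fun x => H (rd x)).
  exact: measurableT_comp mH mrd.
have H0 x : 0 <= H (rd x) by have /andP[] := HK _ (rootabs_ge0 n x).
have m1 : measurable_fun [set: R] (fun x => Phi x * H (rd x)).
  exact: measurable_funM.
have m2 : measurable_fun [set: R] (fun x => Phi (- x) * H (rd x)).
  exact: measurable_funM.
split; first by apply: measurable_funM => //; exact: measurable_funD.
under eq_integral do rewrite mulrDl EFinD.
rewrite ge0_integralD//; last 4 first.
- by move=> x _; rewrite lee_fin mulr_ge0.
- exact/measurable_EFinP.
- by move=> x _; rewrite lee_fin mulr_ge0.
- exact/measurable_EFinP.
rewrite mulrDr EFinD; apply: leeD; first exact: hA Hw.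
have -> : (\int[muk]_x (Phi (- x) * H (rd x))%:E =
    \int[muk]_x (Phi x * H (rd x))%:E)%E.
  rewrite -[RHS]ge0_integral_mukn_opp.
  - by apply: eq_integral => x _; rewrite rootabsN.
  - exact/measurable_EFinP.
  - by move=> x; rewrite lee_fin mulr_ge0.
exact: hA Hw.
Qed.

(** Arbitrary exponential factors in r are affordable. Together with the crude bound |j(w)| <= exp
    |w| this yields existence and differentiability of the transform; the decay of j is reserved for
    the growth estimate. *)
Lemma integrable_majorant_exp (A : R) :
  muk.-integrable [set: R] (EFin \o (fun x => G x * expR (A * rd x))).
Proof.
have [B hB] := Psi_weight.
have [C C0 hC] := @gauss_exp_weight R (n%:R * a) A gam na0 g0.
pose H (r : R) := expR (- (n%:R * a * r ^+ 2) + A * r).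
have mH : measurable_fun [set: R] H.
  apply: measurableT_comp => //; apply: measurable_funD; last exact: measurable_funM.
  by apply: measurableT_comp => //; apply: measurable_funM => //; exact: measurable_funX.
have [||mPH IPH] := hB H C 0 mH.
- by move=> r /hC[h _]; rewrite expR_ge0.
- by move=> r /hC[_ h]; rewrite subr0.
have GE : (fun x => G x * expR (A * rd x)) = (fun x => Psi x * H (rd x)).
  by apply/funext => x; rewrite /H expRD mulrA.
rewrite GE; apply/integrableP; split; first exact/measurable_EFinP.
under eq_integral => x _ do rewrite /= ger0_norm ?mulr_ge0 ?addr_ge0 ?expR_ge0//.
by rewrite (le_lt_trans IPH)// ltry.
Qed.

Lemma cmod_even_part_le x : cmod (even_part f x) <= G x.
Proof.
have e y : Phi y * expR (- (n%:R * a * rd y ^+ 2)) = cmod (f y).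
  by rewrite /Phi mulrAC expRN divff ?mul1r// gt_eqF// expR_gt0.
have -> : G x = cmod (f x) + cmod (f (- x)).
  by rewrite /even_majorant mulrDl e -[in X in _ + X]rootabsN e.
rewrite /even_part cmodM cmodV.
rewrite (_ : cmod 2 = 2); last first.
  by rewrite -real_complex_nat cmod_real normr_nat.
have := cmodD (f x) (f (- x)); have := cmod_ge0 (f x); have := cmod_ge0 (f (- x)).
lra.
Qed.

Lemma even_majorant_ge0 x : 0 <= G x.
Proof. by rewrite mulr_ge0 ?expR_ge0// addr_ge0. Qed.

Lemma cmeasurable_even_part : cmeasurable (even_part f).
Proof.
apply: cmeasurableM; last exact: cmeasurable_cst.
apply: cmeasurableD => //; have [mr mi] := cmf.
by split; [exact: measurableT_comp mr mopp|exact: measurableT_comp mi mopp].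
Qed.

Let lam x : R := n%:R * rd x.

Let lam_ge0 x : 0 <= lam x.
Proof. by rewrite mulr_ge0 ?rootabs_ge0// ltW. Qed.

Let cmod_lam x z : cmod ((lam x)%:C%C * z) = lam x * cmod z.
Proof. by rewrite cmodM cmod_real ger0_norm. Qed.

Let mlam : measurable_fun [set: R] lam.
Proof. exact: measurable_funM. Qed.

Lemma cmeasurable_bessel_sum M z : unit_seq M ->
  cmeasurable (fun x => bessel_sum M ((lam x)%:C%C * z)).
Proof.
move=> uM'; apply: (@cmeasurable_ccvg _ _ _
  (fun m x => \sum_(i < m) bessel_term M ((lam x)%:C%C * z) i)).
  move=> m; apply: (cmeasurable_sum (t := fun i x => bessel_term M ((lam x)%:C%C * z) i)).
  move=> i; apply: cmeasurableM; first exact: cmeasurable_cst.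
  apply: cmeasurableX; apply: cmeasurableM; last exact: cmeasurable_cst.
  exact: cmeasurable_real.
by move=> x; exact: ccvg_bessel_sum.
Qed.

Lemma T1_integrandE z x : T1_integrand k n f z x =
  even_part f x * bessel_sum Mk ((lam x)%:C%C * z).
Proof. by rewrite /T1_integrand jbesselE. Qed.

Lemma cmeasurable_T1_integrand z : cmeasurable (T1_integrand k n f z).
Proof.
rewrite (_ : T1_integrand k n f z =
   fun x => even_part f x * bessel_sum Mk ((lam x)%:C%C * z)); last first.
  by apply/funext => x; exact: T1_integrandE.
apply: cmeasurableM; first exact: cmeasurable_even_part.
exact: cmeasurable_bessel_sum.
Qed.

Lemma cintegrable_T1_integrand z : cintegrable muk (T1_integrand k n f z).
Proof.
apply: (cintegrable_le (cmeasurable_T1_integrand z)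
  (integrable_majorant_exp (n%:R * cmod z))).
move=> x; rewrite T1_integrandE cmodM; apply: ler_pM; rewrite ?cmod_ge0//.
  exact: cmod_even_part_le.
apply: le_trans (cmod_bessel_sum _ uM) _.
by rewrite cmod_lam ler_expR /lam mulrAC.
Qed.

(** The derivative of the integrand in z: by the chain rule, lam times the derivative of the series
    at lam z. *)
Definition T1_derivative_integrand z x : R[i] :=
  even_part f x * ((lam x)%:C%C * (- ((lam x)%:C%C * z)) *
    bessel_sum (derived_moment Mk) ((lam x)%:C%C * z)).

Let sqr_lam_le x : lam x ^+ 2 <= 2 * expR (lam x).
Proof.
have := expR_ge1Dxn 1 (lam_ge0 x); rewrite (_ : 2`!%:R = 2)//.
have := sqr_ge0 (lam x); lra.
Qed.

Lemma cmeasurable_T1_derivative z : cmeasurable (T1_derivative_integrand z).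
Proof.
have mz : cmeasurable (fun x => (lam x)%:C%C * z).
  apply: cmeasurableM; last exact: cmeasurable_cst.
  exact: cmeasurable_real.
have mNz : cmeasurable (fun x => - ((lam x)%:C%C * z)).
  under eq_fun do rewrite -mulN1r.
  by apply: cmeasurableM => //; exact: cmeasurable_cst.
apply: cmeasurableM; first exact: cmeasurable_even_part.
apply: cmeasurableM.
  by apply: cmeasurableM => //; exact: cmeasurable_real.
exact/cmeasurable_bessel_sum/unit_seq_derived_moment.
Qed.

Lemma cintegrable_T1_derivative z : cintegrable muk (T1_derivative_integrand z).
Proof.
have ig := integrableZl_EFin measurableT (2 * cmod z)
  (integrable_majorant_exp (n%:R * (cmod z + 1))).
apply: (cintegrable_le (cmeasurable_T1_derivative z) ig) => x.
have uM' := unit_seq_derived_moment uM.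
rewrite (_ : 2 * cmod z * _ =
  G x * (2 * expR (lam x) * cmod z * expR (lam x * cmod z))); last first.
  rewrite (_ : n%:R * (cmod z + 1) * rd x = lam x + lam x * cmod z).
    by rewrite expRD; ring.
  by rewrite /lam; ring.
rewrite cmodM; apply: ler_pM; rewrite ?cmod_even_part_le ?cmod_ge0//.
rewrite cmodM; apply: ler_pM; rewrite ?cmod_ge0//.
  by rewrite cmod_lam cmodN cmod_lam mulrA -expr2 ler_wpM2r ?cmod_ge0.
by apply: le_trans (cmod_bessel_sum _ uM') _; rewrite cmod_lam.
Qed.

Lemma T1E z : T1 k n f z = cint muk (T1_integrand k n f z).
Proof. by []. Qed.

(** The Taylor estimate of the series at lam z with increment lam h has error lam^2 |h|^2 exp(lam
    (|z| + |h|)), integrable against the majorant. The constant is common to all |h| <= 1, so the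
    difference quotients converge. *)
Lemma T1_taylor1 z : exists2 B, 0 <= B & forall h, cmod h <= 1 ->
  cmod (T1 k n f (z + h) - T1 k n f z - h * cint muk (T1_derivative_integrand z)) <=
  cmod h ^+ 2 * B.
Proof.
(* In |z| + 2, one unit pays for lam^2 <= 2 exp(lam), the other for |h| <= 1. *)
have ig := integrableZl_EFin measurableT 2
  (integrable_majorant_exp (n%:R * (cmod z + 2))).
exists (Rintegral muk [set: R] (fun x => 2 * (G x * expR (n%:R * (cmod z + 2) * rd x)))).
  apply: Rintegral_ge0 => x _; apply: mulr_ge0 => //.
  by apply: mulr_ge0; [exact: even_majorant_ge0|exact: expR_ge0].
move=> h h1.
have iD := cintegrable_T1_derivative z.
have mhD : cmeasurable (fun x => h * T1_derivative_integrand z x).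
  by apply: cmeasurableM; [exact: cmeasurable_cst|exact: cmeasurable_T1_derivative].
have ihD : cintegrable muk (fun x => h * T1_derivative_integrand z x).
  have [r1 i1] := iD; split.
    rewrite (_ : (fun x => _) = (fun x => cre h * cre (T1_derivative_integrand z x)
        - cim h * cim (T1_derivative_integrand z x))).
      by apply: integrableB_EFin => //; exact: integrableZl_EFin.
    by apply/funext => x; rewrite creM.
  rewrite (_ : (fun x => _) = (fun x => cre h * cim (T1_derivative_integrand z x)
      + cim h * cre (T1_derivative_integrand z x))).
    by apply: integrableD_EFin => //; exact: integrableZl_EFin.
  by apply/funext => x; rewrite cimM.
have mdiff : cmeasurable (fun x => T1_integrand k n f (z + h) x - T1_integrand k n f z x).
  under eq_fun do rewrite -[X in _ + X]mulN1r.
  apply: cmeasurableD; first exact: cmeasurable_T1_integrand.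
  apply: cmeasurableM; first exact: cmeasurable_cst.
  exact: cmeasurable_T1_integrand.
have idiff : cintegrable muk
    (fun x => T1_integrand k n f (z + h) x - T1_integrand k n f z x).
  have [r1 i1] := cintegrable_T1_integrand (z + h).
  have [r2 i2] := cintegrable_T1_integrand z; split.
    rewrite (_ : (fun x => _) = (fun x => cre (T1_integrand k n f (z + h) x)
        - cre (T1_integrand k n f z x))); first exact: integrableB_EFin.
    by apply/funext => x; rewrite creD creN.
  rewrite (_ : (fun x => _) = (fun x => cim (T1_integrand k n f (z + h) x)
      - cim (T1_integrand k n f z x))); first exact: integrableB_EFin.
  by apply/funext => x; rewrite cimD cimN.
rewrite !T1E -(cintZ _ iD) -cintB; [|exact: cintegrable_T1_integrand..].
rewrite -cintB// -RintegralZl//; apply: cmod_cint_le.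
- under eq_fun do rewrite -[X in _ + X]mulN1r.
  by apply: cmeasurableD => //; apply: cmeasurableM => //; exact: cmeasurable_cst.
- exact: integrableZl_EFin.
move=> x; rewrite !T1_integrandE /T1_derivative_integrand.
rewrite [X in cmod X](_ : _ = even_part f x *
  (bessel_sum Mk ((lam x)%:C%C * z + (lam x)%:C%C * h)
   - bessel_sum Mk ((lam x)%:C%C * z)
   - (lam x)%:C%C * h * (- ((lam x)%:C%C * z)) *
     bessel_sum (derived_moment Mk) ((lam x)%:C%C * z))); last first.
  by rewrite mulrDr; ring.
rewrite cmodM.
rewrite (_ : cmod h ^+ 2 * _ = G x * (2 * expR (lam x) * cmod h ^+ 2 *
    expR (lam x * (cmod z + 1)))); last first.
  rewrite (_ : n%:R * (cmod z + 2) * rd x = lam x + lam x * (cmod z + 1)).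
    by rewrite expRD; ring.
  by rewrite /lam; ring.
apply: ler_pM; rewrite ?cmod_even_part_le ?cmod_ge0//.
apply: le_trans (bessel_sum_taylor2 _ _ uM) _.
rewrite !cmod_lam exprMn; apply: ler_pM.
- by apply: mulr_ge0; exact: sqr_ge0.
- exact: expR_ge0.
- by apply: ler_wpM2r; [exact: sqr_ge0|exact: sqr_lam_le].
by rewrite -mulrDr ler_expR ler_wpM2l// lerD2l.
Qed.

Lemma T1_derivable z : derivable (T1 k n f : R[i]^o -> R[i]^o) z 1.
Proof.
have [B B0 hB] := T1_taylor1 z; set D := cint _ _ in hB.
apply/cvg_ex; exists (D : R[i]^o); apply/cvgrPdist_lt => e e0.
(* The radius is an element of [R[i]]; its positivity forces it to be real. *)
have ee : e = (complex.Re e)%:C%C by rewrite RRe_real// gtr0_real.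
have e0' : 0 < complex.Re e by rewrite -ltcR -ee.
pose dl : R := Num.min 1 (complex.Re e / (B + 1)).
have dl0 : 0 < dl by rewrite lt_min ltr01 divr_gt0// ltr_pwDr.
near=> h.
have hn0 : h != 0 by near: h; exact: nbhs_dnbhs_neq.
have : `|h| < dl%:C%C by near: h; apply: dnbhs0_lt; rewrite ltcR.
rewrite normE_cmod ltcR lt_min => /andP[h1 h2].
have ch0 : 0 < cmod h.
  by rewrite lt_neqAle cmod_ge0 andbT eq_sym; apply: contra_neq hn0; exact: cmod_eq0.
rewrite normE_cmod ee ltcR.
rewrite (_ : D - _ = - (h^-1 * (T1 k n f (z + h) - T1 k n f z - h * D))); last first.
  rewrite [X in _ - _ *: (X - _)](_ : _ = T1 k n f (z + h)); last first.
    by rewrite /= /GRing.scale/= mulr1 addrC.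
  by rewrite -[_ *: _]/(_ * _) [in RHS]mulrBr mulKf// opprB.
rewrite cmodN cmodM cmodV mulrC ltr_pdivrMr//.
apply: le_lt_trans (hB h (ltW h1)) _.
rewrite expr2 -mulrA [ltRHS]mulrC ltr_pM2l//.
move: h2; rewrite ltr_pdivlMr ?ltr_pwDr// => h2.
by apply: le_lt_trans h2; rewrite ler_pM2l// lerDl.
Unshelve. all: by end_near. Qed.

Lemma T1_growth : exists C : R, 0 < C /\ forall z,
  cmod (T1 k n f z) <= C * expR (n%:R / (4 * a) * (cim z) ^+ 2).
Proof.
have [B hB] := Psi_weight.
have [K K0 hK] := jbessel_decay al.
have m0 : 0 < 2 * n%:R * a by rewrite -mulrA mulr_gt0.
have [C C0 hC] := shifted_gauss_weight na0 m0 g0.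
have B0 : 0 <= `|B| by [].
(* The sign of B is unknown, hence its absolute value; the final 1 keeps the constant positive even
   if B = 0. *)
exists (K * ((1 + C) * `|B|) + 1); split.
  by rewrite ltr_wpDl// !mulr_ge0// ?addr_ge0// ltW.
move=> z; set E := expR (_ * _).
have E0 : 0 < E by exact: expR_gt0.
(* The point where -n a r^2 + n r |Im z| is largest. *)
pose b := `|cim z| / (2 * a).
have b0 : 0 <= b by rewrite divr_ge0// mulr_ge0// ltW.
pose H (r : R) := expR (- (n%:R * a * (r - b) ^+ 2)) / (1 + (2 * n%:R * a * b * r) `^ gam).
have d0 (r : R) : 0 < 1 + (2 * n%:R * a * b * r) `^ gam by rewrite ltr_pwDl// powR_ge0.
have mH : measurable_fun [set: R] H.
  apply: measurable_funM.
    apply: measurableT_comp => //; apply: measurableT_comp => //.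
    apply: measurable_funM => //; apply: measurable_funX.
    exact: measurable_funB.
  rewrite (_ : (fun r => _) = (fun r => (1 + (2 * n%:R * a * b * r) `^ gam) `^ (-1))).
    apply: (measurableT_comp (measurable_powR _)); apply: measurable_funD => //.
    by apply: (measurableT_comp (measurable_powR _)); exact: measurable_funM.
  by apply/funext => r; rewrite powR_inv1// ltW.
have H1 r : 0 <= H r <= 1.
  rewrite divr_ge0 ?expR_ge0 ?(ltW (d0 r))//= ler_pdivrMr// mul1r.
  rewrite (@le_trans _ _ 1)// ?lerDl ?powR_ge0//.
  by rewrite -[leRHS]expR0 ler_expR oppr_le0 mulr_ge0 ?sqr_ge0// ltW.
(* [1 + C] meets both demands on the weight: the bound 1 on [H] and the constant C of its decay. *)
have [||mPH IPH] := hB H (1 + C) b mH.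
- move=> r _; have /andP[-> h] := H1 r.
  by rewrite (le_trans h)// lerDl ltW.
- move=> r r0; apply: le_trans (hC r b r0 b0) _.
  by rewrite ler_wpM2r ?lerDr// invr_ge0 addr_ge0// sqr_ge0.
have PH0 x : 0 <= Psi x * H (rd x).
  by rewrite mulr_ge0 ?addr_ge0//; have /andP[] := H1 (rd x).
have iPH : muk.-integrable [set: R] (EFin \o (fun x => Psi x * H (rd x))).
  apply/integrableP; split; first exact/measurable_EFinP.
  under eq_integral => x _ do rewrite /= ger0_norm//.
  by rewrite (le_lt_trans IPH)// ltry.
have RPH : Rintegral muk [set: R] (fun x => Psi x * H (rd x)) <= (1 + C) * `|B|.
  rewrite -lee_fin /Rintegral fineK; last exact: integrable_fin_num iPH.
  apply: le_trans IPH _; rewrite lee_fin ler_wpM2l ?ler_norm//.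
  by rewrite addr_ge0// ltW.
rewrite T1E.
apply: (@le_trans _ _ (Rintegral muk [set: R] (fun x => (K * E) * (Psi x * H (rd x))))).
  apply: cmod_cint_le; first exact: cmeasurable_T1_integrand.
    exact: integrableZl_EFin.
  move=> x; rewrite /T1_integrand cmodM.
  have -> : K * E * (Psi x * H (rd x)) =
     G x * (K * expR (lam x * `|cim z|) / (1 + (lam x * `|cim z|) `^ gam)).
    rewrite /H /even_majorant /E.
    have -> : 2 * n%:R * a * b * rd x = lam x * `|cim z|.
      by rewrite /b /lam; field; rewrite gt_eqF.
    have eE : expR (n%:R / (4 * a) * cim z ^+ 2) * expR (- (n%:R * a * (rd x - b) ^+ 2)) =
        expR (- (n%:R * a * rd x ^+ 2)) * expR (lam x * `|cim z|).
      rewrite -!expRD; congr expR; rewrite /b /lam -(real_normK (num_real (cim z))).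
      by field; rewrite gt_eqF.
    transitivity (K * (expR (n%:R / (4 * a) * cim z ^+ 2) *
       expR (- (n%:R * a * (rd x - b) ^+ 2))) * Psi x /
       (1 + (lam x * `|cim z|) `^ gam)); first by ring.
    by rewrite eE; ring.
  apply: ler_pM; rewrite ?cmod_ge0 ?cmod_even_part_le//.
  by have := hK ((lam x)%:C%C * z); rewrite cimZ normrM ger0_norm.
rewrite RintegralZl//.
have := ler_wpM2l (mulr_ge0 (ltW K0) (ltW E0)) RPH.
move: (Rintegral _ _ _) => I h; apply: le_trans h _.
apply: (@le_trans _ _ (K * ((1 + C) * `|B|) * E)); first by rewrite mulrAC.
by rewrite [leRHS]mulrDl mul1r lerDl ltW.
Qed.

End bessel_transform.

Theorem lemma2p1 (R : realType) (n : nat) (k : R) (p : \bar R) (a : R)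
    (f : R -> R[i]) :
  (1 <= n)%N ->
  (n%:R - 1) / (2 * n%:R) <= k ->
  (1 <= p)%E ->
  0 < a ->
  measurable_fun [set: R] (@cre R \o f) ->
  measurable_fun [set: R] (@cim R \o f) ->
  (Lnorm (mukn k n) p
     (fun x => (expR (n%:R * a * `|x| `^ (2 / n%:R)) * cmod (f x))%:E)
   < +oo)%E ->
  (forall z : R[i], T1_defined k n f z) /\
  (forall z : R[i], derivable (T1 k n f : R[i]^o -> R[i]^o) z 1) /\
  (exists C : R, 0 < C /\
     forall z : R[i],
       cmod (T1 k n f z) <= C * expR (n%:R / (4 * a) * (cim z) ^+ 2)).
Proof.
move=> n1 hk p1 a0 mre mim fp; split; [|split].
- by move=> z; exact: (cintegrable_T1_integrand n1 hk p1 a0 mre mim fp z).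
- by move=> z; exact: (T1_derivable n1 hk p1 a0 mre mim fp).
- exact: (T1_growth n1 hk p1 a0 mre mim fp).
Qed.
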